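(* (Möbius inversion formula.) Let $\kappa>3/\pi$ and $\nu\in(0,\infty)$ be real, and let $\eta_{\kappa\nu}$ be given by its expansion $$\eta_{\kappa\nu}(s)=\eta(s)+\sum_{n=1}^{\infty}a_n(\kappa)\,\eta(s+2\nu n).$$ Then for every $s\in\mathbb{C}$, $$\eta(s)=\eta_{\kappa\nu}(s)+\sum_{n=1}^{\infty}b_n(\kappa)\,\eta_{\kappa\nu}(s+2\nu n),$$ where the coefficients $b_n(\kappa)$, $n\ge0$, are recursively obtained from $$\sum_{n=0}^{k}b_n(\kappa)\,a_{k-n}(\kappa)=\delta_{k0}\qquad(k=0,1,2,\ldots),$$ with $\delta_{k0}=1$ if $k=0$ and $\delta_{k0}=0$ otherwise.
   Context: The Dirichlet eta function is the entire function given for all $s\in\mathbb{C}$ by $\eta(s)=\sum_{k=0}^{\infty}\frac{1}{2^{k+1}}\sum_{m=0}^{k}\binom{k}{m}\frac{(-1)^{m}}{(m+1)^{s}}$ (equal to $\sum_{m\ge1}(-1)^{m-1}m^{-s}$ for $\operatorname{Re}s>0$). For real $x$ and $\kappa\in(0,\infty)$, $$\mathcal{B}_{\kappa}(x):=\frac12\left[\tanh\left(\frac{x+\frac12}{\kappa}\right)-\tanh\left(\frac{x-\frac12}{\kappa}\right)\right].$$ For real $\kappa,\nu\in(0,\infty)$ and $s\in\mathbb{C}$, $$\eta_{\kappa\nu}(s):=\sum_{k=0}^{\infty}\frac{1}{2^{k+1}}\sum_{m=0}^{k}\binom{k}{m}\frac{(-1)^{m}}{(m+1)^{s}}\,\frac{\mathcal{B}_{\kappa}\left(1/(m+1)^{\nu}\right)}{\mathcal{B}_{\kappa}(0)}.$$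 For $\kappa>3/\pi$ and integers $n\ge0$, $$a_n(\kappa)=\frac{1}{\tanh\left(\frac{1}{2\kappa}\right)}\sum_{j=n+1}^{\infty}\frac{2^{2n}(2^{2j}-1)B_{2j}}{j\,(2j-2n-1)!\,(2n)!\,\kappa^{2j-1}},$$ with $B_{2j}$ the even Bernoulli numbers ($B_2=\frac16$, $B_4=-\frac1{30}$, etc.); one has $a_0(\kappa)=1$. *)

(* Defs.v *)
From Stdlib Require Import Reals Lia Arith.
From Coquelicot Require Import Coquelicot.
Open Scope R_scope.

Definition Cexp (z : C) : C := (exp (Re z) * cos (Im z), exp (Re z) * sin (Im z)).

(* [x ^ s] with the principal (real) logarithm; meaningful only for [0 < x]. *)
Definition Rcpow (x : R) (s : C) : C := Cexp (s * RtoC (ln x))%C.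

(* Componentwise, as Coquelicot does for complex integrals: this is the sum
   whenever [ex_series u], and has no meaning otherwise. *)
Definition CSeries (u : nat -> C) : C :=
  (Series (fun n => Re (u n)), Series (fun n => Im (u n))).

Lemma CSeries_unique (u : nat -> C) (l : C) : is_series u l -> CSeries u = l.
Proof.
intros Hu.
assert (Hsum : forall n,
  sum_n u n = (sum_n (fun k => Re (u k)) n, sum_n (fun k => Im (u k)) n)).
{ induction n as [|n IH].
  - rewrite !sum_O; apply surjective_pairing.
  - rewrite !sum_Sn, IH; reflexivity. }
unfold CSeries; rewrite (surjective_pairing l); f_equal; apply is_series_unique.
- apply filterlim_ext with (fun n => fst (sum_n u n)).
  + intros n; rewrite Hsum; reflexivity.
  + intros P [e He]; apply (Hu (fun z => P (fst z))); exists e.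
    intros y [Hy _]; now apply He.
- apply filterlim_ext with (fun n => snd (sum_n u n)).
  + intros n; rewrite Hsum; reflexivity.
  + intros P [e He]; apply (Hu (fun z => P (snd z))); exists e.
    intros y [_ Hy]; now apply He.
Qed.

(* After importing Coquelicot, [C] is the type of complex numbers, so the
   binomial coefficient has to be qualified: [Binomial.C n k] for [k <= n]. *)

(* [bernoulli_upto n k] is B_k for [k <= n]. *)
Fixpoint bernoulli_upto (n : nat) : nat -> R :=
  match n with
  | O => fun _ => 1
  | S p => fun k =>
      if (k <=? p)%nat then bernoulli_upto p k
      else - sum_n (fun j => Binomial.C (S (S p)) j * bernoulli_upto p j) p
             / INR (S (S p))
  end.

Definition bernoulli (n : nat) : R := bernoulli_upto n n.

Lemma bernoulli_2 : bernoulli 2 = 1 / 6.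
Proof.
unfold bernoulli; simpl; rewrite ?sum_Sn, ?sum_O.
unfold plus, Binomial.C; simpl; unfold plus; simpl; field.
Qed.

Lemma bernoulli_4 : bernoulli 4 = - (1 / 30).
Proof.
unfold bernoulli; simpl; rewrite ?sum_Sn, ?sum_O.
unfold plus, Binomial.C; simpl; unfold plus; simpl; field.
Qed.

Lemma bernoulli_upto_stable (n k : nat) :
  (k <= n)%nat -> bernoulli_upto n k = bernoulli k.
Proof.
induction n as [|n IH]; intros Hk.
- now replace k with 0%nat by lia.
- destruct (Nat.eq_dec k (S n)) as [->|Hne]; [reflexivity|].
  simpl; replace (k <=? n)%nat with true
    by (symmetry; apply Nat.leb_le; lia).
  apply IH; lia.
Qed.

Lemma bernoulli_rec (n : nat) :
  sum_n (fun j => Binomial.C (S (S n)) j * bernoulli j) (S n) = 0.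
Proof.
rewrite sum_Sn.
assert (HB : bernoulli (S n) =
  - sum_n (fun j => Binomial.C (S (S n)) j * bernoulli j) n / INR (S (S n))).
{ unfold bernoulli at 1; cbn [bernoulli_upto].
  replace (S n <=? n)%nat with false by (symmetry; apply Nat.leb_gt; lia).
  do 2 f_equal; apply sum_n_ext_loc; intros j Hj.
  now rewrite bernoulli_upto_stable. }
rewrite HB.
assert (HC : Binomial.C (S (S n)) (S n) = INR (S (S n))).
{ unfold Binomial.C; replace (S (S n) - S n)%nat with 1%nat by lia.
  rewrite (fact_simpl (S n)), mult_INR; change (INR (fact 1)) with 1.
  field; apply INR_fact_neq_0. }
rewrite HC.
change (sum_n (fun j => Binomial.C (S (S n)) j * bernoulli j) n +
  INR (S (S n)) * (- sum_n (fun j => Binomial.C (S (S n)) j * bernoulli j) n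
  / INR (S (S n))) = 0).
field; now apply not_0_INR.
Qed.

Definition eta (s : C) : C :=
  CSeries (fun k =>
    (RtoC (1 / 2 ^ (k + 1)) *
     sum_n (fun m => RtoC (Binomial.C k m) * (RtoC ((-1) ^ m)
                     / Rcpow (INR (m + 1)) s)) k)%C).

Definition calB (kappa x : R) : R :=
  1 / 2 * (tanh ((x + 1 / 2) / kappa) - tanh ((x - 1 / 2) / kappa)).

Definition eta_kn (kappa nu : R) (s : C) : C :=
  CSeries (fun k =>
    (RtoC (1 / 2 ^ (k + 1)) *
     sum_n (fun m => RtoC (Binomial.C k m) * (RtoC ((-1) ^ m)
                     / Rcpow (INR (m + 1)) s)
                     * RtoC (calB kappa (1 / Rpower (INR (m + 1)) nu)
                             / calB kappa 0)) k)%C).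

(* The sum over j >= n + 1 is reindexed by j = n + 1 + i; with this j the
   natural-number subtractions below are not truncated. *)
Definition acoef (kappa : R) (n : nat) : R :=
  1 / tanh (1 / (2 * kappa)) *
  Series (fun i =>
    let j := (n + 1 + i)%nat in
    2 ^ (2 * n) * (2 ^ (2 * j) - 1) * bernoulli (2 * j)
    / (INR j * INR (fact (2 * j - 2 * n - 1)) * INR (fact (2 * n))
       * kappa ^ (2 * j - 1))).

(* Main.v *)
Require Import Defs.
From Stdlib Require Import Reals Lra Lia Arith.
From Coquelicot Require Import Coquelicot.
Open Scope R_scope.

(** Write [z m = (m+1)^(-2 nu)].  Replacing [s] by [s + 2 nu n] multiplies the [m]-th
    Dirichlet term [(m+1)^-s] by [z m ^ n], while passing from [eta] to [eta_kn]
    multiplies it by [A (z m)], where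
    [A (x^2) = calB kappa x / calB kappa 0 = sum_n a_n x^(2n)].  Both formulas are thus
    the identities [A = sum_n a_n z^n] and [1 = A * sum_n b_n z^n], read under the
    linear functional sending a sequence to the sum of its Euler-transformed
    alternating series, once this functional may be exchanged with the sum over [n].

    The expansion of [A] for [x] between 0 and 1 comes from the Taylor series of [tanh], whose
    coefficients are tied to the Bernoulli numbers by
    [x tanh x = x + b(4x) - b(2x)] with [b(x) = x/(exp x - 1)] near 0
    ([tanh_pseries_near_0]).  The equation [tanh' = 1 - tanh^2] becomes a recursion on
    coefficients; by comparison with [tan' = 1 + tan^2] the partial sums of their
    absolute values stay below [tan], so the series converges to [tanh] up to [PI/2]
    ([abs_partial_le_tan], [tanh_pseries]).  The arguments [(x + 1/2)/kappa] and
    [(x - 1/2)/kappa] stay in this range up to [x = 1] exactly because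
    [3/PI < kappa] ([acoef_expansion]).

    The reciprocal of [A] is known in closed form, since
    [calB kappa x = sinh(1/kappa) / (cosh(2x/kappa) + cosh(1/kappa))]; its Taylor
    series converges everywhere ([bcoef_pseries]), and uniqueness of power series
    identifies its coefficients with the convolution inverse of the [a_n]
    ([bcoef_conv], [conv_inverse_unique]).

    The exchange of sums is Fubini for absolutely convergent double series
    ([tame_superposition]).  It needs the Euler-transformed series of
    [(m+1)^-(s + 2 nu n)] to converge absolutely, with sums bounded in [n].  When the
    real part of the exponent is at least 2 a comparison with [1/((m+1)(m+2))] gives a
    uniform bound; the finitely many remaining [n] reduce to this case by taking
    enough finite differences, each of which gains one power of [m] ([tame_osc]). *)

(** * Double series *)

Lemma ex_series_bounded (a : nat -> R) (M : R) :
  (forall n, 0 <= a n) -> (forall n, sum_f_R0 a n <= M) ->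
  ex_series a /\ Series a <= M.
Proof.
intros Ha HM.
assert (Hex : ex_series a).
{ destruct (ex_finite_lim_seq_incr (sum_n a) M) as [l Hl].
  - intros n; rewrite sum_Sn; change (sum_n a n <= sum_n a n + a (S n)).
    specialize (Ha (S n)); lra.
  - intros n; rewrite sum_n_Reals; apply HM.
  - now exists l. }
split; [assumption|].
change (Rbar_le (Series a) M).
apply is_lim_seq_le with (sum_n a) (fun _ => M).
- intros n; rewrite sum_n_Reals; apply HM.
- exact (Series_correct a Hex).
- apply is_lim_seq_const.
Qed.

Lemma Series_nonneg (a : nat -> R) :
  (forall n, 0 <= a n) -> ex_series a -> 0 <= Series a.
Proof.
intros Ha Hex; change (Rbar_le 0 (Series a)).
apply is_lim_seq_le with (fun _ => 0) (sum_n a).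
- intros n; rewrite sum_n_Reals; now apply cond_pos_sum.
- apply is_lim_seq_const.
- exact (Series_correct a Hex).
Qed.

Lemma ex_series_abs_le (a b : nat -> R) :
  (forall n, Rabs (a n) <= b n) -> ex_series b ->
  ex_series (fun n => Rabs (a n)).
Proof.
intros Hab Hb; apply (ex_series_le (V := R_CompleteNormedModule) _ b); [|assumption].
intros n; change (Rabs (Rabs (a n)) <= b n); now rewrite Rabs_Rabsolu.
Qed.

Lemma partial_sum_le_Series (a : nat -> R) (n : nat) :
  (forall k, 0 <= a k) -> ex_series a -> sum_f_R0 a n <= Series a.
Proof.
intros Ha Hex; rewrite (Series_incr_n a (S n)) by (lia || assumption).
assert (H : 0 <= Series (fun k => a (S n + k)%nat)).
{ apply Series_nonneg; [intros k; apply Ha|].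
  now apply (ex_series_incr_n a (S n)). }
simpl in *; lra.
Qed.

Lemma Series_sum_f_R0 (w : nat -> nat -> R) (N : nat) :
  (forall k, (k <= N)%nat -> ex_series (w k)) ->
  ex_series (fun n => sum_f_R0 (fun k => w k n) N) /\
  Series (fun n => sum_f_R0 (fun k => w k n) N) = sum_f_R0 (fun k => Series (w k)) N.
Proof.
induction N as [|N IH]; intros Hw; simpl.
- split; [apply (ex_series_ext (w 0%nat)); [reflexivity|apply Hw; lia]|reflexivity].
- destruct IH as [He Heq]; [intros; apply Hw; lia|].
  split.
  + apply (ex_series_plus (V := R_NormedModule)); [assumption|apply Hw; lia].
  + rewrite Series_plus, Heq; [reflexivity|assumption|apply Hw; lia].
Qed.

Lemma le_Series (a : nat -> R) (n : nat) :
  (forall k, 0 <= a k) -> ex_series a -> a n <= Series a.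
Proof.
intros Ha Hex; apply Rle_trans with (sum_f_R0 a n);
  [|now apply partial_sum_le_Series].
destruct n as [|n]; simpl; [lra|].
pose proof (cond_pos_sum a n Ha); lra.
Qed.

(** One half of Tonelli: a partial sum of the column sums is a sum over rows of
    partial row sums, hence at most the total taken row by row.  Using it on the
    array and on its transpose gives the equality. *)
Lemma tonelli_le (w : nat -> nat -> R) :
  (forall n k, 0 <= w n k) -> (forall n, ex_series (w n)) ->
  ex_series (fun n => Series (w n)) ->
  (forall k, ex_series (fun n => w n k)) /\
  ex_series (fun k => Series (fun n => w n k)) /\
  Series (fun k => Series (fun n => w n k)) <= Series (fun n => Series (w n)).
Proof.
intros Hpos Hrow Htot.
assert (Hcol : forall k, ex_series (fun n => w n k)).
{ intros k; apply (ex_series_le (V := R_CompleteNormedModule) _ (fun n => Series (w n)));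
    [|assumption].
  intros n; change (Rabs (w n k) <= Series (w n)).
  rewrite Rabs_pos_eq by apply Hpos; now apply le_Series. }
split; [assumption|].
apply ex_series_bounded.
- intros k; now apply Series_nonneg.
- intros K; rewrite <- (proj2 (Series_sum_f_R0 (fun k n => w n k) K (fun k _ => Hcol k))).
  apply Series_le; [|assumption].
  intros n; split; [now apply cond_pos_sum|now apply partial_sum_le_Series].
Qed.

Lemma tonelli (w : nat -> nat -> R) :
  (forall n k, 0 <= w n k) -> (forall n, ex_series (w n)) ->
  ex_series (fun n => Series (w n)) ->
  Series (fun k => Series (fun n => w n k)) = Series (fun n => Series (w n)).
Proof.
intros Hpos Hrow Htot.
destruct (tonelli_le w Hpos Hrow Htot) as (Hcol & Hex & Hle).
apply Rle_antisym; [assumption|].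
now apply (tonelli_le (fun k n => w n k)).
Qed.

(** The signed array is the difference of the nonnegative arrays [w + |w|] and
    [|w|], to which Tonelli applies. *)
Lemma fubini (w : nat -> nat -> R) :
  (forall n, ex_series (fun k => Rabs (w n k))) ->
  ex_series (fun n => Series (fun k => Rabs (w n k))) ->
  (forall k, ex_series (fun n => Rabs (w n k))) /\
  ex_series (fun k => Series (fun n => Rabs (w n k))) /\
  Series (fun k => Series (fun n => w n k)) = Series (fun n => Series (w n)).
Proof.
intros Hrow Htot.
destruct (tonelli_le (fun n k => Rabs (w n k))) as (Hcol & Hex & _);
  [intros; apply Rabs_pos|assumption|assumption|].
split; [assumption|split; [assumption|]].
assert (Hpos : forall n k, 0 <= w n k + Rabs (w n k)).
{ intros n k; generalize (Rle_abs (- w n k)); rewrite Rabs_Ropp; lra. }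
assert (Hr : forall n, ex_series (w n)) by (intros n; now apply ex_series_Rabs).
assert (Hc : forall k, ex_series (fun n => w n k))
  by (intros k; now apply ex_series_Rabs).
assert (Hr2 : forall n, ex_series (fun k => w n k + Rabs (w n k)))
  by (intros n; now apply (ex_series_plus (V := R_NormedModule))).
assert (Hsr : ex_series (fun n => Series (w n))).
{ apply ex_series_Rabs.
  apply ex_series_abs_le with (fun n => Series (fun k => Rabs (w n k))); [|assumption].
  intros n; now apply Series_Rabs. }
assert (Hsc : ex_series (fun k => Series (fun n => w n k))).
{ apply ex_series_Rabs.
  apply ex_series_abs_le with (fun k => Series (fun n => Rabs (w n k))); [|assumption].
  intros n; now apply (Series_Rabs (fun k => w k n)). }
assert (HT := tonelli (fun n k => w n k + Rabs (w n k)) Hpos Hr2).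
rewrite (Series_ext _ (fun k => Series (fun n => w n k) + Series (fun n => Rabs (w n k))))
  in HT by (intros k; now apply (Series_plus (fun n => w n k))).
rewrite (Series_ext (fun n => Series (fun k => w n k + Rabs (w n k)))
  (fun n => Series (w n) + Series (fun k => Rabs (w n k)))) in HT
  by (intros n; now apply (Series_plus (w n))).
rewrite !Series_plus in HT by assumption.
rewrite (tonelli (fun n k => Rabs (w n k))) in HT;
  [|intros; apply Rabs_pos|assumption|assumption].
assert (H : ex_series (fun n => Series (fun k => w n k + Rabs (w n k)))).
{ apply (ex_series_ext (fun n => Series (w n) + Series (fun k => Rabs (w n k)))).
  - intros n; symmetry; now apply (Series_plus (w n)).
  - now apply (ex_series_plus (V := R_NormedModule)). }
specialize (HT H); lra.
Qed.

(** * The Euler transform of oscillating powers *)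

(** The [k]-th term of Euler's transformation of the alternating series of [f]. *)
Definition eulerT (f : nat -> R) (k : nat) : R :=
  1 / 2 ^ (k + 1) * sum_f_R0 (fun m => Binomial.C k m * ((-1) ^ m * f m)) k.

Lemma binomial_coef_nonneg (n k : nat) : 0 <= Binomial.C n k.
Proof.
unfold Binomial.C; apply Rmult_le_pos; [apply pos_INR|].
apply Rlt_le, Rinv_0_lt_compat, Rmult_lt_0_compat; apply INR_fact_lt_0.
Qed.

Lemma sum_binomial_coef (n : nat) : sum_f_R0 (Binomial.C n) n = 2 ^ n.
Proof.
replace 2 with (1 + 1) by ring; rewrite binomial.
apply sum_eq; intros i _; rewrite !pow1; ring.
Qed.

Lemma binomial_coef_shift2 (k m : nat) : (m <= k)%nat ->
  Binomial.C k m / ((INR m + 1) * (INR m + 2))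
  = Binomial.C (S (S k)) (S (S m)) / ((INR k + 1) * (INR k + 2)).
Proof.
intros Hm; unfold Binomial.C.
replace (S (S k) - S (S m))%nat with (k - m)%nat by lia.
rewrite !(fact_simpl (S _)), !(fact_simpl k), !(fact_simpl m), !mult_INR, !S_INR.
pose proof (pos_INR k); pose proof (pos_INR m).
field; repeat split; try apply INR_fact_neq_0; lra.
Qed.

Lemma sum_binomial_coef_shift2_le (k : nat) :
  sum_f_R0 (fun m => Binomial.C (S (S k)) (S (S m))) k <= 2 ^ (k + 2).
Proof.
replace (k + 2)%nat with (S (S k)) by lia.
rewrite <- sum_binomial_coef, (decomp_sum (Binomial.C (S (S k)))) by lia.
simpl Init.Nat.pred; rewrite (decomp_sum (fun i => Binomial.C (S (S k)) (S i))) by lia.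
simpl Init.Nat.pred.
pose proof (binomial_coef_nonneg (S (S k)) 0).
pose proof (binomial_coef_nonneg (S (S k)) 1); lra.
Qed.

(** Weighting [C(k, m)] by [1/((m+1)(m+2))] turns it into [C(k+2, m+2)], up to the
    factor [(k+1)(k+2)]; this gains two powers of [k] over the trivial bound. *)
Lemma eulerT_le (f : nat -> R) (M : R) :
  (forall m, Rabs (f m) <= M / ((INR m + 1) * (INR m + 2))) ->
  forall k, Rabs (eulerT f k) <= 2 * M / ((INR k + 1) * (INR k + 2)).
Proof.
intros Hf k.
assert (HM : 0 <= M).
{ specialize (Hf 0%nat); simpl in Hf; pose proof (Rabs_pos (f 0%nat)); lra. }
pose proof (pos_INR k) as Hk.
assert (H2 : 0 < 2 ^ (k + 1)) by (apply pow_lt; lra).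
unfold eulerT; rewrite Rabs_mult, (Rabs_pos_eq (1 / _))
  by (apply Rlt_le, Rdiv_lt_0_compat; lra).
apply Rle_trans with (1 / 2 ^ (k + 1) * (M / ((INR k + 1) * (INR k + 2)) * 2 ^ (k + 2))).
- apply Rmult_le_compat_l; [apply Rlt_le, Rdiv_lt_0_compat; lra|].
  eapply Rle_trans; [apply Rsum_abs|].
  apply Rle_trans with (sum_f_R0 (fun m => Binomial.C (S (S k)) (S (S m))
      * (M / ((INR k + 1) * (INR k + 2)))) k).
  + apply sum_Rle; intros m Hm.
    rewrite !Rabs_mult, pow_1_abs, Rmult_1_l, (Rabs_pos_eq (Binomial.C k m))
      by apply binomial_coef_nonneg.
    replace (Binomial.C (S (S k)) (S (S m)) * (M / ((INR k + 1) * (INR k + 2))))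
      with (M * (Binomial.C (S (S k)) (S (S m)) / ((INR k + 1) * (INR k + 2))))
      by (field; lra).
    rewrite <- binomial_coef_shift2 by assumption.
    replace (M * (Binomial.C k m / ((INR m + 1) * (INR m + 2))))
      with (Binomial.C k m * (M / ((INR m + 1) * (INR m + 2))))
      by (pose proof (pos_INR m); field; lra).
    apply Rmult_le_compat_l; [apply binomial_coef_nonneg|apply Hf].
  + rewrite <- scal_sum.
    apply Rmult_le_compat_l.
    * apply Rmult_le_pos; [assumption|].
      apply Rlt_le, Rinv_0_lt_compat, Rmult_lt_0_compat; lra.
    * rewrite <- (Rmult_1_l (2 ^ _)), <- (Rmult_1_l (sum_f_R0 _ _)).
      apply Rmult_le_compat_l; [lra|apply sum_binomial_coef_shift2_le].
- right; replace (k + 2)%nat with (S (k + 1)) by lia.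
  simpl; field; repeat split; lra.
Qed.

Lemma ex_series_inv_quadratic :
  ex_series (fun k => / ((INR k + 1) * (INR k + 2))) /\
  Series (fun k => / ((INR k + 1) * (INR k + 2))) <= 1.
Proof.
apply ex_series_bounded.
- intros k; pose proof (pos_INR k).
  apply Rlt_le, Rinv_0_lt_compat, Rmult_lt_0_compat; lra.
- intros N.
  replace (sum_f_R0 _ N) with (1 - / (INR N + 2)).
  + pose proof (pos_INR N).
    assert (0 < / (INR N + 2)) by (apply Rinv_0_lt_compat; lra); lra.
  + induction N as [|N IH]; [simpl; field|].
    rewrite tech5, <- IH, S_INR; pose proof (pos_INR N); field; lra.
Qed.

Lemma eulerT_abs_summable (f : nat -> R) (M : R) :
  (forall m, Rabs (f m) <= M / ((INR m + 1) * (INR m + 2))) ->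
  ex_series (fun k => Rabs (eulerT f k)) /\
  Series (fun k => Rabs (eulerT f k)) <= 2 * M.
Proof.
intros Hf; pose proof (eulerT_le f M Hf) as Hle.
destruct ex_series_inv_quadratic as [Hex H1].
assert (HM : 0 <= M).
{ specialize (Hf 0%nat); simpl in Hf; pose proof (Rabs_pos (f 0%nat)); lra. }
assert (Hex2 : ex_series (fun k => 2 * M * / ((INR k + 1) * (INR k + 2))))
  by now apply (ex_series_scal_l (V := R_NormedModule) (2 * M)).
split.
- eapply ex_series_abs_le; [exact Hle|assumption].
- apply Rle_trans with (Series (fun k => 2 * M * / ((INR k + 1) * (INR k + 2)))).
  + apply Series_le; [|assumption].
    intros k; split; [apply Rabs_pos|apply Hle].
  + rewrite Series_scal_l.
    apply Rle_trans with (2 * M * 1); [|lra].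
    apply Rmult_le_compat_l; lra.
Qed.

(** Pascal's rule; for an alternating [g] it trades one step in [k] for one
    difference of the sequence, as used in [eulerT_S]. *)
Lemma sum_binomial_coef_S (g : nat -> R) (k : nat) :
  sum_f_R0 (fun m => Binomial.C (S k) m * g m) (S k)
  = sum_f_R0 (fun m => Binomial.C k m * (g m + g (S m))) k.
Proof.
rewrite decomp_sum by lia; simpl Init.Nat.pred.
assert (HC0 : forall n, Binomial.C n 0 = 1).
{ intros n; unfold Binomial.C; rewrite Nat.sub_0_r; simpl; field.
  apply INR_fact_neq_0. }
assert (HCn : forall n, Binomial.C n n = 1).
{ intros n; unfold Binomial.C; rewrite Nat.sub_diag; simpl; field.
  apply INR_fact_neq_0. }
rewrite (sum_eq (fun m => Binomial.C k m * (g m + g (S m)))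
  (fun m => Binomial.C k m * g m + Binomial.C k m * g (S m))) by (intros; ring).
rewrite sum_plus, HC0.
destruct k as [|k]; [simpl; rewrite !HC0, HCn; ring|].
rewrite (decomp_sum (fun m => Binomial.C (S k) m * g m)) by lia.
simpl Init.Nat.pred; rewrite HC0, !tech5, !HCn.
rewrite (sum_eq (fun i => Binomial.C (S (S k)) (S i) * g (S i))
  (fun i => Binomial.C (S k) i * g (S i) + Binomial.C (S k) (S i) * g (S i))).
- rewrite sum_plus; ring.
- intros i Hi; rewrite <- pascal by lia; ring.
Qed.

Definition fwd_diff (f : nat -> R) (m : nat) : R := f m - f (S m).

Lemma eulerT_S (f : nat -> R) (k : nat) :
  eulerT f (S k) = / 2 * eulerT (fwd_diff f) k.
Proof.
unfold eulerT; rewrite sum_binomial_coef_S.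
rewrite (sum_eq _ (fun m => Binomial.C k m * ((-1) ^ m * fwd_diff f m)))
  by (intros m _; unfold fwd_diff; simpl; ring).
replace (S k + 1)%nat with (S (k + 1)) by lia; simpl; field.
apply pow_nonzero; lra.
Qed.

Lemma eulerT_abs_summable_of_diff (p : nat) (f : nat -> R) :
  ex_series (fun k => Rabs (eulerT (Nat.iter p fwd_diff f) k)) ->
  ex_series (fun k => Rabs (eulerT f k)).
Proof.
revert f; induction p as [|p IH]; intros f H; [exact H|].
rewrite Nat.iter_succ_r in H; apply IH in H.
apply ex_series_incr_1.
apply (ex_series_ext (fun k => / 2 * Rabs (eulerT (fwd_diff f) k))).
- intros k; rewrite eulerT_S, Rabs_mult, (Rabs_pos_eq (/ 2)) by lra; reflexivity.
- now apply (ex_series_scal_l (V := R_NormedModule) (/ 2)).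
Qed.

(** With [s = sigma + i t], the real and imaginary parts of [y ^ -s] are the values
    at [(A, B) = (1, 0)] and [(0, -1)]; the family is closed under differentiation. *)
Definition osc (t A B sigma y : R) : R :=
  exp (- sigma * ln y) * (A * cos (t * ln y) + B * sin (t * ln y)).

Lemma osc_le (t A B sigma y : R) :
  Rabs (osc t A B sigma y) <= (Rabs A + Rabs B) * exp (- sigma * ln y).
Proof.
unfold osc; rewrite Rabs_mult, Rmult_comm, (Rabs_pos_eq (exp _))
  by apply Rlt_le, exp_pos.
apply Rmult_le_compat_r; [apply Rlt_le, exp_pos|].
eapply Rle_trans; [apply Rabs_triang|]; rewrite !Rabs_mult.
apply Rplus_le_compat; rewrite <- (Rmult_1_r (Rabs _)) at 2;
  (apply Rmult_le_compat_l; [apply Rabs_pos|apply Rabs_le]);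
  [apply COS_bound|apply SIN_bound].
Qed.

Lemma is_derive_osc (t A B sigma y : R) : 0 < y ->
  is_derive (osc t A B sigma) y
    (osc t (- sigma * A + t * B) (- sigma * B - t * A) (sigma + 1) y).
Proof.
intros Hy; unfold osc; auto_derive; [repeat split; assumption|].
replace (- (sigma + 1) * ln y) with (- sigma * ln y + - ln y) by ring.
rewrite exp_plus, exp_Ropp, exp_ln by assumption.
field; lra.
Qed.

Fixpoint real_diff (p : nat) (f : R -> R) (y : R) : R :=
  match p with
  | O => f y
  | S p => real_diff p f y - real_diff p f (y + 1)
  end.

Lemma is_derive_real_diff (p : nat) (f df : R -> R) :
  (forall y, 0 < y -> is_derive f y (df y)) ->
  forall y, 0 < y -> is_derive (real_diff p f) y (real_diff p df y).
Proof.
intros Hf; induction p as [|p IH]; intros y Hy; simpl; [now apply Hf|].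
apply (is_derive_minus (V := R_NormedModule)); [now apply IH|].
replace (real_diff p df (y + 1)) with (1 * real_diff p df (y + 1)) by ring.
apply (is_derive_comp (real_diff p f) (fun y => y + 1)); [apply IH; lra|].
auto_derive; [exact I|ring].
Qed.

(** Each difference gains one power of [y], by the mean value theorem and the
    bound for one difference less of the derivative. *)
Lemma real_diff_osc_le (t : R) (p : nat) : forall A B sigma,
  exists M, forall y, 1 <= y ->
  Rabs (real_diff p (osc t A B sigma) y) <= M * exp (- (sigma + INR p) * ln y).
Proof.
induction p as [|p IH]; intros A B sigma.
- exists (Rabs A + Rabs B); intros y Hy; simpl; rewrite Rplus_0_r; apply osc_le.
- destruct (IH (- sigma * A + t * B) (- sigma * B - t * A) (sigma + 1)) as [M HM].
  assert (HM0 : 0 <= M).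
  { specialize (HM 1 (Rle_refl 1)); rewrite ln_1, Rmult_0_r, exp_0 in HM.
    pose proof (Rabs_pos (real_diff p (osc t (- sigma * A + t * B)
      (- sigma * B - t * A) (sigma + 1)) 1)); lra. }
  set (e := sigma + INR (S p)).
  (* The intermediate point lies between [y] and [y + 1 <= 2 y]; replacing it by [y]
     costs at most a factor [2^|e|]. *)
  exists (M * exp (Rabs e * ln 2)); intros y Hy; simpl real_diff.
  set (F := real_diff p (osc t A B sigma)).
  set (dF := real_diff p (osc t (- sigma * A + t * B) (- sigma * B - t * A) (sigma + 1))).
  assert (HF : forall c, 0 < c -> is_derive F c (dF c)).
  { intros c Hc; apply is_derive_real_diff; [|assumption].
    intros; now apply is_derive_osc. }
  destruct (MVT_gen F y (y + 1) dF) as (c & Hc & Heq).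
  + intros x; rewrite Rmin_left, Rmax_right by lra; intros; apply HF; lra.
  + intros x; rewrite Rmin_left, Rmax_right by lra; intros.
    apply derivable_continuous_pt; exists (dF x); apply is_derive_Reals, HF; lra.
  + rewrite Rmin_left, Rmax_right in Hc by lra.
    replace (F y - F (y + 1)) with (- dF c) by lra; rewrite Rabs_Ropp.
    eapply Rle_trans; [apply HM; lra|].
    rewrite Rmult_assoc, <- exp_plus; apply Rmult_le_compat_l; [assumption|].
    replace (sigma + 1 + INR p) with e by (unfold e; rewrite S_INR; ring).
    assert (Hl0 : ln y <= ln c) by (apply ln_le; lra).
    assert (Hl1 : ln c <= ln y + ln 2) by (rewrite <- ln_mult by lra; apply ln_le; lra).
    assert (Hexp : - e * ln c <= Rabs e * ln 2 + - e * ln y).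
    { assert (- e * (ln c - ln y) <= Rabs e * ln 2); [|lra].
      apply Rle_trans with (Rabs e * (ln c - ln y)).
      - apply Rmult_le_compat_r; [lra|]; rewrite <- Rabs_Ropp; apply Rle_abs.
      - apply Rmult_le_compat_l; [apply Rabs_pos|lra]. }
    destruct Hexp as [Hlt| ->]; [left; now apply exp_increasing|right; reflexivity].
Qed.

Lemma iter_fwd_diff (p : nat) (F : R -> R) (m : nat) :
  Nat.iter p fwd_diff (fun m => F (INR m + 1)) m = real_diff p F (INR m + 1).
Proof.
revert m; induction p as [|p IH]; intros m; [reflexivity|].
simpl; unfold fwd_diff; rewrite !IH, S_INR; reflexivity.
Qed.

Lemma exp_ln_le_inv_quadratic (tau : R) (m : nat) : 2 <= tau ->
  exp (- tau * ln (INR m + 1)) <= 2 / ((INR m + 1) * (INR m + 2)).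
Proof.
intros Ht; pose proof (pos_INR m) as Hm.
assert (Hln : 0 <= ln (INR m + 1)) by (rewrite <- ln_1; apply ln_le; lra).
apply Rle_trans with (exp (- (ln (INR m + 1) + ln (INR m + 1)))).
- assert (H : - tau * ln (INR m + 1) <= - (ln (INR m + 1) + ln (INR m + 1))) by nra.
  destruct H as [H| ->]; [left; now apply exp_increasing|right; reflexivity].
- rewrite exp_Ropp, exp_plus, exp_ln by lra.
  apply (Rmult_le_reg_r ((INR m + 1) * (INR m + 1) * (INR m + 2)));
    [repeat apply Rmult_lt_0_compat; lra|].
  replace (/ _ * _) with (INR m + 2) by (field; lra).
  replace (2 / _ * _) with (2 * (INR m + 1)) by (field; lra); lra.
Qed.

Lemma eulerT_osc_abs_summable (t A B sigma : R) :
  ex_series (fun k => Rabs (eulerT (fun m => osc t A B sigma (INR m + 1)) k)).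
Proof.
destruct (nfloor_ex (Rabs (2 - sigma)) (Rabs_pos _)) as [p [_ Hp]].
destruct (real_diff_osc_le t (S p) A B sigma) as [M HM].
apply (eulerT_abs_summable_of_diff (S p)).
apply (eulerT_abs_summable _ (M * 2)); intros m; rewrite iter_fwd_diff.
pose proof (pos_INR m).
assert (HM0 : 0 <= M).
{ specialize (HM 1 (Rle_refl 1)); rewrite ln_1, Rmult_0_r, exp_0 in HM.
  pose proof (Rabs_pos (real_diff (S p) (osc t A B sigma) 1)); lra. }
eapply Rle_trans; [apply HM; lra|].
unfold Rdiv; rewrite Rmult_assoc; apply Rmult_le_compat_l; [assumption|].
apply exp_ln_le_inv_quadratic; rewrite S_INR.
pose proof (Rle_abs (2 - sigma)); lra.
Qed.

(** Absolute convergence of the Euler-transformed series of [f * z ^ n], uniformly in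
    [n]: what is needed to sum these series against a summable family of
    coefficients. *)
Definition tame (f z : nat -> R) : Prop := exists K, forall n,
  ex_series (fun k => Rabs (eulerT (fun m => f m * z m ^ n) k)) /\
  Series (fun k => Rabs (eulerT (fun m => f m * z m ^ n) k)) <= K.

Lemma eventually_bounded (u : nat -> R) (N : nat) (K : R) :
  (forall n, 0 <= u n) -> (forall n, (N <= n)%nat -> u n <= K) ->
  forall n, u n <= K + sum_f_R0 u N.
Proof.
intros Hu HK n.
assert (HK0 : 0 <= K) by (apply Rle_trans with (u N); [apply Hu|apply HK; lia]).
destruct (le_lt_dec N n) as [Hn|Hn].
- pose proof (HK n Hn); pose proof (cond_pos_sum u N Hu); lra.
- assert (H : u n <= sum_f_R0 u N); [|lra].
  clear - Hu Hn; induction N as [|N IH]; [lia|]; simpl.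
  destruct (Nat.eq_dec n N) as [->|]; [|specialize (Hu (S N)); specialize (IH ltac:(lia)); lra].
  destruct N as [|N]; simpl.
  + specialize (Hu 1%nat); lra.
  + pose proof (cond_pos_sum u N Hu); specialize (Hu (S (S N))); lra.
Qed.

Lemma exp_pow_INR (x : R) (n : nat) : exp x ^ n = exp (x * INR n).
Proof.
induction n as [|n IH]; [simpl; now rewrite Rmult_0_r, exp_0|].
simpl pow; rewrite IH, <- exp_plus, S_INR; f_equal; ring.
Qed.

Lemma osc_mult_exp (t A B sigma tau y : R) (n : nat) :
  osc t A B sigma y * exp (- tau * ln y) ^ n = osc t A B (sigma + tau * INR n) y.
Proof.
unfold osc; rewrite exp_pow_INR.
replace (- (sigma + tau * INR n) * ln y) with (- sigma * ln y + - tau * ln y * INR n) by ring.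
rewrite exp_plus; ring.
Qed.

Lemma eulerT_ext (f g : nat -> R) (k : nat) :
  (forall m, f m = g m) -> eulerT f k = eulerT g k.
Proof.
intros H; unfold eulerT; f_equal; apply sum_eq; intros m _; now rewrite H.
Qed.

(** Once the real part of the exponent reaches 2 the terms are dominated by
    [1/((m+1)(m+2))] with a constant independent of [n]; only finitely many [n]
    come before. *)
Lemma tame_osc (t A B sigma tau : R) : 0 < tau ->
  tame (fun m => osc t A B sigma (INR m + 1)) (fun m => exp (- tau * ln (INR m + 1))).
Proof.
intros Htau; unfold tame.
set (S0 := fun n => Series (fun k => Rabs (eulerT
  (fun m => osc t A B (sigma + tau * INR n) (INR m + 1)) k))).
destruct (nfloor_ex (Rabs ((2 - sigma) / tau)) (Rabs_pos _)) as [N [_ HN]].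
set (K := 2 * ((Rabs A + Rabs B) * 2)).
exists (K + sum_f_R0 S0 (S N)); intros n.
assert (Hext : forall k, Rabs (eulerT (fun m => osc t A B (sigma + tau * INR n) (INR m + 1)) k)
  = Rabs (eulerT (fun m => osc t A B sigma (INR m + 1)
      * exp (- tau * ln (INR m + 1)) ^ n) k)).
{ intros k; f_equal; apply eulerT_ext; intros m; now rewrite osc_mult_exp. }
rewrite <- (Series_ext _ _ Hext); split.
- eapply ex_series_ext; [exact Hext|]; apply eulerT_osc_abs_summable.
- apply (eventually_bounded S0).
  + intros n'; apply Series_nonneg; [intros; apply Rabs_pos|].
    apply eulerT_osc_abs_summable.
  + intros n' Hn'; apply eulerT_abs_summable; intros m.
    eapply Rle_trans; [apply osc_le|].
    unfold Rdiv; rewrite Rmult_assoc; apply Rmult_le_compat_l;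
      [apply Rplus_le_le_0_compat; apply Rabs_pos|].
    apply exp_ln_le_inv_quadratic.
    apply le_INR in Hn'; rewrite S_INR in Hn'.
    pose proof (Rle_abs ((2 - sigma) / tau)).
    assert (H1 : (2 - sigma) / tau <= INR n') by lra.
    apply (Rmult_le_compat_l tau) in H1; [|lra].
    replace (tau * ((2 - sigma) / tau)) with (2 - sigma) in H1 by (field; lra); lra.
Qed.

(** * Superpositions of shifted series *)

Lemma ex_series_abs_pseries (c : nat -> R) (x : R) :
  ex_series (fun n => Rabs (c n)) -> 0 <= x <= 1 ->
  ex_series (fun n => Rabs (c n * x ^ n)).
Proof.
intros Hc Hx; apply ex_series_abs_le with (fun n => Rabs (c n)); [|assumption].
intros n; rewrite Rabs_mult; rewrite <- (Rmult_1_r (Rabs (c n))) at 2.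
apply Rmult_le_compat_l; [apply Rabs_pos|].
rewrite Rabs_pos_eq by (apply pow_le; lra).
rewrite <- (pow1 n); apply pow_incr; lra.
Qed.

Lemma eulerT_pseries (f z c : nat -> R) (k : nat) :
  (forall m, 0 <= z m <= 1) -> ex_series (fun n => Rabs (c n)) ->
  eulerT (fun m => f m * PSeries c (z m)) k
  = Series (fun n => c n * eulerT (fun m => f m * z m ^ n) k).
Proof.
intros Hz Hc; unfold eulerT.
set (w := fun m n => Binomial.C k m * ((-1) ^ m * f m) * (c n * z m ^ n)).
assert (Hw : forall m, ex_series (w m)).
{ intros m; apply (ex_series_scal_l (V := R_NormedModule)).
  apply ex_series_Rabs; now apply ex_series_abs_pseries. }
destruct (Series_sum_f_R0 w k) as [_ Heq]; [intros; apply Hw|].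
rewrite (Series_ext _ (fun n => 1 / 2 ^ (k + 1) * sum_f_R0 (fun m => w m n) k)).
- rewrite Series_scal_l, Heq; f_equal; apply sum_eq; intros m _.
  unfold w; rewrite Series_scal_l; unfold PSeries; ring.
- intros n.
  rewrite (sum_eq (fun m => w m n)
    (fun m => Binomial.C k m * ((-1) ^ m * (f m * z m ^ n)) * c n))
    by (intros; unfold w; ring).
  rewrite <- scal_sum; ring.
Qed.

(** Interchange of the Euler-transformed sum with a summable superposition of the
    shifts [f * z ^ n], by Fubini; the superposition can again be shifted. *)
Lemma tame_superposition (f z c : nat -> R) :
  (forall m, 0 <= z m <= 1) -> ex_series (fun n => Rabs (c n)) -> tame f z ->
  ex_series (fun n => c n * Series (eulerT (fun m => f m * z m ^ n))) /\
  Series (fun n => c n * Series (eulerT (fun m => f m * z m ^ n)))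
    = Series (eulerT (fun m => f m * PSeries c (z m))) /\
  tame (fun m => f m * PSeries c (z m)) z.
Proof.
intros Hz Hc [K HK].
assert (HK0 : 0 <= K).
{ eapply Rle_trans; [|apply (HK 0%nat)].
  apply Series_nonneg; [intros; apply Rabs_pos|apply (HK 0%nat)]. }
assert (Hfub : forall p,
  let w := fun n k => c n * eulerT (fun m => f m * z m ^ (p + n)) k in
  (forall k, ex_series (fun n => Rabs (w n k))) /\
  ex_series (fun k => Series (fun n => Rabs (w n k))) /\
  Series (fun k => Series (fun n => Rabs (w n k))) <= Series (fun n => Rabs (c n)) * K /\
  Series (fun k => Series (fun n => w n k)) = Series (fun n => Series (w n))).
{ intros p w.
  assert (Hrow : forall n, ex_series (fun k => Rabs (w n k))).
  { intros n; apply (ex_series_ext (fun k => Rabs (c n)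
      * Rabs (eulerT (fun m => f m * z m ^ (p + n)) k))).
    - intros k; symmetry; apply Rabs_mult.
    - apply (ex_series_scal_l (V := R_NormedModule)), HK. }
  assert (Hle : forall n, 0 <= Series (fun k => Rabs (w n k)) <= Rabs (c n) * K).
  { intros n; split; [apply Series_nonneg; [intros; apply Rabs_pos|apply Hrow]|].
    rewrite (Series_ext _ (fun k => Rabs (c n)
      * Rabs (eulerT (fun m => f m * z m ^ (p + n)) k)))
      by (intros k; apply Rabs_mult).
    rewrite Series_scal_l; apply Rmult_le_compat_l; [apply Rabs_pos|apply HK]. }
  assert (HcK : ex_series (fun n => Rabs (c n) * K))
    by now apply (ex_series_scal_r K).
  assert (Htot : ex_series (fun n => Series (fun k => Rabs (w n k)))).
  { apply (ex_series_le (V := R_CompleteNormedModule) _ (fun n => Rabs (c n) * K));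
      [|assumption].
    intros n; change (Rabs (Series (fun k => Rabs (w n k))) <= Rabs (c n) * K).
    rewrite Rabs_pos_eq; apply Hle. }
  destruct (fubini w Hrow Htot) as (H1 & H2 & H3).
  split; [assumption|split; [assumption|split; [|assumption]]].
  rewrite (tonelli (fun n k => Rabs (w n k)));
    [|intros; apply Rabs_pos|assumption|assumption].
  rewrite <- Series_scal_r; apply Series_le; [apply Hle|assumption]. }
split; [|split].
- apply ex_series_Rabs; apply ex_series_abs_le with (fun n => Rabs (c n) * K).
  + intros n; rewrite Rabs_mult; apply Rmult_le_compat_l; [apply Rabs_pos|].
    eapply Rle_trans; [apply Series_Rabs|]; apply HK.
  + now apply (ex_series_scal_r K).
- destruct (Hfub 0%nat) as (_ & _ & _ & Heq); simpl in Heq.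
  rewrite (Series_ext (eulerT (fun m => f m * PSeries c (z m)))
    (fun k => Series (fun n => c n * eulerT (fun m => f m * z m ^ n) k)))
    by (intros k; now apply eulerT_pseries).
  rewrite Heq; apply Series_ext; intros n; now rewrite Series_scal_l.
- exists (Series (fun n => Rabs (c n)) * K); intros p.
  destruct (Hfub p) as (H1 & H2 & H3 & _).
  set (w := fun n k => c n * eulerT (fun m => f m * z m ^ (p + n)) k) in *.
  assert (Hle : forall k, 0 <= Rabs (eulerT (fun m => f m * PSeries c (z m) * z m ^ p) k)
    <= Series (fun n => Rabs (w n k))).
  { intros k; split; [apply Rabs_pos|].
    rewrite (eulerT_ext _ (fun m => f m * z m ^ p * PSeries c (z m)))
      by (intros; ring).
    rewrite eulerT_pseries by assumption.
    rewrite (Series_ext _ (fun n => w n k)); [apply Series_Rabs, H1|].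
    intros n; unfold w; f_equal; apply eulerT_ext; intros m; rewrite pow_add; ring. }
  split.
  + apply ex_series_abs_le with (fun k => Series (fun n => Rabs (w n k)));
      [apply Hle|assumption].
  + eapply Rle_trans; [|exact H3]; now apply Series_le.
Qed.

Lemma superposition_tail (f z c : nat -> R) :
  (forall m, 0 <= z m <= 1) -> ex_series (fun n => Rabs (c n)) -> c 0%nat = 1 -> tame f z ->
  ex_series (fun n => c (n + 1)%nat * Series (eulerT (fun m => f m * z m ^ (n + 1)))) /\
  Series (eulerT (fun m => f m * PSeries c (z m)))
  = Series (eulerT f)
    + Series (fun n => c (n + 1)%nat * Series (eulerT (fun m => f m * z m ^ (n + 1)))).
Proof.
intros Hz Hc Hc0 Hf.
destruct (tame_superposition f z c Hz Hc Hf) as (Hex & <- & _).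
assert (Hext : forall n, c (S n) * Series (eulerT (fun m => f m * z m ^ S n))
  = c (n + 1)%nat * Series (eulerT (fun m => f m * z m ^ (n + 1)))).
{ intros n; now rewrite Nat.add_1_r. }
split.
- eapply ex_series_ext; [exact Hext|].
  now apply (ex_series_incr_1 (fun n => c n * Series (eulerT (fun m => f m * z m ^ n)))).
- rewrite Series_incr_1, (Series_ext _ _ Hext), Hc0, Rmult_1_l by assumption.
  f_equal; apply Series_ext; intros k; apply eulerT_ext; intros m; simpl; ring.
Qed.

(** * Bernoulli numbers and tanh near 0 *)

Definition bern_egf (n : nat) : R := bernoulli n / INR (fact n).

Definition exp_coef (n : nat) : R := / INR (fact n).

Definition unit_coef (n : nat) : R := if Nat.eqb n 0 then 1 else 0.

Lemma PSeries_unit_coef (x : R) : ex_pseries unit_coef x /\ PSeries unit_coef x = 1.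
Proof.
assert (H : ex_pseries unit_coef x).
{ apply ex_pseries_R, ex_series_incr_1.
  apply (ex_series_ext (fun _ => 0)).
  - intros n; unfold unit_coef; simpl; ring.
  - apply (ex_series_bounded _ 0); [intros; lra|].
    intros n; rewrite sum_cte; lra. }
split; [assumption|].
rewrite PSeries_decr_1 by assumption.
rewrite (PSeries_ext _ (fun _ => 0)) by reflexivity.
rewrite PSeries_const_0; unfold unit_coef; simpl; ring.
Qed.

Lemma CV_radius_ge_of_ex_pseries (a : nat -> R) (x : R) :
  ex_pseries a x -> Rbar_le (Rabs x) (CV_radius a).
Proof.
intros H; apply Rbar_not_lt_le; intros Hlt.
apply (CV_disk_outside a x Hlt).
apply ex_series_lim_0; now apply ex_pseries_R.
Qed.

Lemma lt_CV_radius_of_ball (a : nat -> R) (r x : R) :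
  (forall z, Rabs z < r -> ex_pseries a z) -> Rabs x < r -> Rbar_lt (Rabs x) (CV_radius a).
Proof.
intros Ha Hx; pose proof (Rabs_pos x).
assert (Hm : Rabs ((Rabs x + r) / 2) = (Rabs x + r) / 2) by (apply Rabs_pos_eq; lra).
apply Rbar_lt_le_trans with (Rabs ((Rabs x + r) / 2)); [simpl; lra|].
apply CV_radius_ge_of_ex_pseries, Ha; lra.
Qed.

Lemma bern_egf_rec (n : nat) :
  sum_f_R0 (fun j => bern_egf j / INR (fact (S (S n) - j))) (S n) = 0.
Proof.
pose proof (bernoulli_rec n) as H; rewrite sum_n_Reals in H.
apply (Rmult_eq_reg_r (INR (fact (S (S n))))); [|apply INR_fact_neq_0].
rewrite Rmult_0_l, <- H at 1; rewrite Rmult_comm, scal_sum.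
apply sum_eq; intros j _; unfold bern_egf, Binomial.C.
field; split; apply INR_fact_neq_0.
Qed.

Lemma pow2_le_fact_S (k : nat) : 2 ^ k <= INR (fact (S k)).
Proof.
induction k as [|k IH]; [simpl; lra|].
rewrite fact_simpl, mult_INR; simpl pow.
apply Rmult_le_compat; [lra|apply pow_le; lra| |assumption].
rewrite !S_INR; pose proof (pos_INR k); lra.
Qed.

(** The recursion expresses [B_(n+1)/(n+1)!] through the earlier values with
    weights [1/2!, 1/3!, ...], whose sum is below 1. *)
Lemma bern_egf_le_1 (n : nat) : Rabs (bern_egf n) <= 1.
Proof.
induction n as [n IH] using (well_founded_induction lt_wf).
destruct n as [|n].
- unfold bern_egf, bernoulli; simpl; rewrite Rdiv_1_r, Rabs_R1; lra.
- pose proof (bern_egf_rec n) as H; rewrite tech5 in H.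
  replace (S (S n) - S n)%nat with 1%nat in H by lia.
  change (INR (fact 1)) with 1 in H; rewrite Rdiv_1_r in H.
  replace (bern_egf (S n))
    with (- sum_f_R0 (fun j => bern_egf j / INR (fact (S (S n) - j))) n) by lra.
  rewrite Rabs_Ropp; eapply Rle_trans; [apply Rsum_abs|].
  apply Rle_trans with (sum_f_R0 (fun j => / 2 ^ (S n - j)) n).
  + apply sum_Rle; intros j Hj.
    replace (S (S n) - j)%nat with (S (S n - j)) by lia.
    unfold Rdiv; rewrite Rabs_mult, <- (Rmult_1_l (/ 2 ^ _)).
    apply Rmult_le_compat; [apply Rabs_pos|apply Rabs_pos|apply IH; lia|].
    rewrite Rabs_pos_eq by apply Rlt_le, Rinv_0_lt_compat, INR_fact_lt_0.
    apply Rinv_le_contravar; [apply pow_lt; lra|apply pow2_le_fact_S].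
  + assert (Hg : forall n, sum_f_R0 (fun j => / 2 ^ (S n - j)) n = 1 - / 2 ^ S n).
    { clear; intros n; induction n as [|n IH]; [simpl; field|].
      rewrite tech5; replace (S (S n) - S n)%nat with 1%nat by lia.
      rewrite (sum_eq _ (fun j => / 2 ^ (S n - j) * / 2)).
      - rewrite <- scal_sum, IH; simpl; field; apply pow_nonzero; lra.
      - intros j Hj; replace (S (S n) - j)%nat with (S (S n - j)) by lia.
        simpl pow; field; apply pow_nonzero; lra. }
    rewrite Hg.
    assert (0 < / 2 ^ S n) by (apply Rinv_0_lt_compat, pow_lt; lra); lra.
Qed.

Lemma bern_egf_radius (x : R) : Rabs x < 1 -> Rbar_lt (Rabs x) (CV_radius bern_egf).
Proof.
intros Hx; apply Rbar_lt_le_trans with 1; [exact Hx|].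
apply (CV_radius_bounded bern_egf); exists 1; intros n.
rewrite pow1, Rmult_1_r; apply bern_egf_le_1.
Qed.

Lemma exp_coef_radius (x : R) : Rbar_lt (Rabs x) (CV_radius exp_coef).
Proof.
apply Rbar_lt_le_trans with (Rabs (Rabs x + 1)).
- simpl; rewrite (Rabs_pos_eq (Rabs x + 1)); pose proof (Rabs_pos x); lra.
- apply CV_radius_ge_of_ex_pseries; eexists; apply is_exp_Reals.
Qed.

(** Convolving [B_n/n!] with [1/n!] gives back [B_n/n!] except in degree 1: this is
    the recursion of the Bernoulli numbers. *)
Lemma bern_egf_gf (x : R) : Rabs x < 1 -> PSeries bern_egf x * (exp x - 1) = x.
Proof.
intros Hx.
assert (Hb := bern_egf_radius x Hx); assert (He := exp_coef_radius x).
destruct (PSeries_unit_coef x) as [Hu1 Hu2].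
assert (H : PSeries bern_egf x * exp x = PSeries bern_egf x + x).
{ rewrite exp_Reals; change (fun n => / INR (fact n)) with exp_coef.
  rewrite <- PSeries_mult by assumption.
  rewrite <- (Rmult_1_r x) at 3; rewrite <- Hu2, <- PSeries_incr_1, <- PSeries_plus;
    [|now apply CV_radius_inside|now apply ex_pseries_incr_1].
  apply PSeries_ext; intros n; unfold PS_mult, PS_plus, exp_coef.
  destruct n as [|[|n]].
  - simpl; unfold plus, zero; simpl. field.
  - simpl; unfold bern_egf, bernoulli, unit_coef, plus; simpl; rewrite sum_O; unfold Binomial.C; simpl; field.
  - rewrite tech5, Nat.sub_diag; simpl PS_incr_1.
    rewrite (sum_eq _ (fun j => bern_egf j / INR (fact (S (S n) - j)))) by reflexivity.
    rewrite bern_egf_rec; unfold unit_coef, plus; simpl; field. }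
lra.
Qed.

Definition bern_dilate (n : nat) : R := 4 ^ n * bern_egf n - 2 ^ n * bern_egf n.

(** The Taylor coefficients of [tanh] in terms of Bernoulli numbers:
    [x tanh x = x + b(4x) - b(2x)] with [b(x) = x/(exp x - 1)]. *)
Definition tanh_coef : nat -> R := PS_plus (PS_decr_1 bern_dilate) unit_coef.

Lemma PSeries_dilate (a : nat -> R) (c x : R) :
  PSeries (fun n => c ^ n * a n) x = PSeries a (c * x).
Proof. apply Series_ext; intros n; rewrite Rpow_mult_distr; ring. Qed.

Lemma bern_dilate_gf (x : R) : Rabs x < / 4 ->
  ex_pseries bern_dilate x /\
  PSeries bern_dilate x = PSeries bern_egf (4 * x) - PSeries bern_egf (2 * x).
Proof.
intros Hx.
assert (H : forall c, 0 < c <= 4 -> ex_pseries (fun n => c ^ n * bern_egf n) x).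
{ intros c Hc; apply ex_pseries_R.
  apply (ex_series_ext (fun n => bern_egf n * (c * x) ^ n)).
  - intros n; rewrite Rpow_mult_distr.
    change (bern_egf n * (c ^ n * x ^ n) = c ^ n * bern_egf n * x ^ n); ring.
  - apply ex_pseries_R, CV_radius_inside, bern_egf_radius.
    rewrite Rabs_mult, Rabs_pos_eq by lra; pose proof (Rabs_pos x); nra. }
split.
- apply (ex_pseries_minus (fun n => 4 ^ n * bern_egf n) (fun n => 2 ^ n * bern_egf n));
    apply H; lra.
- rewrite <- !PSeries_dilate, <- PSeries_minus by (apply H; lra); reflexivity.
Qed.

Lemma ex_pseries_tanh_coef (x : R) : Rabs x < / 4 -> ex_pseries tanh_coef x.
Proof.
intros Hx; apply (ex_pseries_plus (V := R_NormedModule)).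
- destruct (bern_dilate_gf x Hx) as [H _].
  apply ex_pseries_decr_1; [|assumption].
  destruct (Req_dec x 0) as [->|Hx0]; [left; reflexivity|right].
  exists (/ x); now apply Rinv_l.
- apply PSeries_unit_coef.
Qed.

Lemma tanh_coef_radius (x : R) : Rabs x < / 4 -> Rbar_lt (Rabs x) (CV_radius tanh_coef).
Proof. apply lt_CV_radius_of_ball; intros z; apply ex_pseries_tanh_coef. Qed.

Lemma tanh_pseries_near_0 (x : R) : Rabs x < / 4 -> PSeries tanh_coef x = tanh x.
Proof.
intros Hx.
assert (H0 : bern_dilate 0 = 0) by (unfold bern_dilate; simpl; ring).
destruct (Req_dec x 0) as [->|Hx0].
- rewrite PSeries_0; unfold tanh; rewrite sinh_0, Rdiv_0_l; unfold tanh_coef, PS_plus, PS_decr_1, bern_dilate, bern_egf,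
    bernoulli, unit_coef, plus; simpl; rewrite sum_O; unfold Binomial.C; simpl; field.
- apply (Rmult_eq_reg_l x); [|assumption].
  destruct (bern_dilate_gf x Hx) as [Hex Heq].
  destruct (PSeries_unit_coef x) as [Hu1 Hu2].
  unfold tanh_coef; rewrite PSeries_plus; [|
    apply ex_pseries_decr_1; [right; exists (/ x); now apply Rinv_l|assumption]|assumption].
  pose proof (PSeries_decr_1 bern_dilate x Hex) as Hd; rewrite H0, Heq in Hd.
  rewrite Hu2, Rmult_plus_distr_l, Rmult_1_r.
  replace (x * PSeries (PS_decr_1 bern_dilate) x)
    with (PSeries bern_egf (4 * x) - PSeries bern_egf (2 * x)) by lra.
  assert (H4 : PSeries bern_egf (4 * x) * (exp (4 * x) - 1) = 4 * x).
  { apply bern_egf_gf; rewrite Rabs_mult, Rabs_pos_eq; lra. }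
  assert (H2 : PSeries bern_egf (2 * x) * (exp (2 * x) - 1) = 2 * x).
  { apply bern_egf_gf; rewrite Rabs_mult, Rabs_pos_eq; pose proof (Rabs_pos x); lra. }
  unfold tanh, sinh, cosh.
  assert (He4 : exp (4 * x) = exp x * exp x * exp x * exp x)
    by (rewrite <- !exp_plus; f_equal; ring).
  assert (He2 : exp (2 * x) = exp x * exp x) by (rewrite <- exp_plus; f_equal; ring).
  rewrite He4 in H4; rewrite He2 in H2; rewrite exp_Ropp.
  set (E := exp x) in *.
  assert (HE : 0 < E) by apply exp_pos.
  assert (HE1 : E * E - 1 <> 0).
  { intros Hc; rewrite Hc in H2; lra. }
  assert (HE2 : E * E * E * E - 1 <> 0).
  { intros Hc; rewrite Hc in H4; lra. }
  replace (PSeries bern_egf (4 * x)) with (4 * x / (E * E * E * E - 1))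
    by (apply (Rmult_eq_reg_r (E * E * E * E - 1)); [rewrite H4; field|]; assumption).
  replace (PSeries bern_egf (2 * x)) with (2 * x / (E * E - 1))
    by (apply (Rmult_eq_reg_r (E * E - 1)); [rewrite H2; field|]; assumption).
  field; repeat split; try assumption; try lra; nra.
Qed.

(** * The Taylor series of tanh up to PI/2 *)

Lemma cosh_pos (x : R) : 0 < cosh x.
Proof. unfold cosh; pose proof (exp_pos x); pose proof (exp_pos (- x)); lra. Qed.

Lemma is_derive_tanh (x : R) : is_derive tanh x (1 - tanh x * tanh x).
Proof.
unfold tanh, sinh, cosh; pose proof (exp_pos x); pose proof (exp_pos (- x)).
auto_derive; [repeat split; lra|field; lra].
Qed.

(** The differential equation [y' = 1 - y^2] of [tanh], read on Taylor coefficients. *)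
Lemma tanh_coef_rec (n : nat) :
  INR (S n) * tanh_coef (S n) = unit_coef n - PS_mult tanh_coef tanh_coef n.
Proof.
assert (Hex : forall x, Rabs x < / 4 -> ex_pseries (PS_mult tanh_coef tanh_coef) x).
{ intros x Hx; now apply ex_pseries_mult; apply tanh_coef_radius. }
apply (PSeries_ext_recip (PS_derive tanh_coef)
  (PS_minus unit_coef (PS_mult tanh_coef tanh_coef)) n).
- rewrite CV_radius_derive, <- Rabs_R0; apply tanh_coef_radius; rewrite Rabs_R0; lra.
- apply Rbar_lt_le_trans with (Rabs (/ 8)); [simpl; rewrite Rabs_pos_eq; lra|].
  apply CV_radius_ge_of_ex_pseries.
  apply (ex_pseries_minus unit_coef (PS_mult tanh_coef tanh_coef)).
  + apply PSeries_unit_coef.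
  + apply Hex; rewrite Rabs_pos_eq; lra.
- assert (H4 : 0 < / 4) by lra.
  exists (mkposreal _ H4); intros x Hx.
  change (Rabs (x - 0) < / 4) in Hx; rewrite Rminus_0_r in Hx.
  rewrite PSeries_minus; [|apply PSeries_unit_coef|now apply Hex].
  rewrite (proj2 (PSeries_unit_coef x)), PSeries_mult by now apply tanh_coef_radius.
  rewrite tanh_pseries_near_0 by assumption.
  rewrite <- (is_derive_unique _ _ _ (is_derive_tanh x)).
  symmetry; apply is_derive_unique.
  apply (is_derive_ext_loc (PSeries tanh_coef));
    [|now apply is_derive_PSeries, tanh_coef_radius].
  assert (Hd : 0 < / 4 - Rabs x) by lra.
  exists (mkposreal _ Hd); intros y Hy; change (Rabs (y - x) < / 4 - Rabs x) in Hy.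
  apply tanh_pseries_near_0.
  replace y with ((y - x) + x) by ring.
  pose proof (Rabs_triang (y - x) x); lra.
Qed.

Lemma tanh_coef_0 : tanh_coef 0 = 0.
Proof.
rewrite <- PSeries_0, tanh_pseries_near_0 by (rewrite Rabs_R0; lra).
unfold tanh; rewrite sinh_0; apply Rdiv_0_l.
Qed.

Lemma tanh_coef_even (i : nat) : tanh_coef (2 * i) = 0.
Proof.
induction i as [i IH] using (well_founded_induction lt_wf).
destruct i as [|i]; [apply tanh_coef_0|].
replace (2 * S i)%nat with (S (2 * i + 1)) by lia.
apply (Rmult_eq_reg_l (INR (S (2 * i + 1)))); [|now apply not_0_INR].
rewrite tanh_coef_rec, Rmult_0_r; unfold PS_mult.
rewrite (sum_eq _ (fun _ => 0)).
- rewrite sum_cte; unfold unit_coef.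
  replace (2 * i + 1 =? 0)%nat with false by (symmetry; apply Nat.eqb_neq; lia); ring.
- intros l Hl; destruct (Nat.Even_or_Odd l) as [[m Hm]|[m Hm]].
  + rewrite Hm, IH by lia; ring.
  + replace (2 * i + 1 - l)%nat with (2 * (i - m))%nat by lia.
    rewrite (IH (i - m)%nat) by lia; ring.
Qed.

Definition abs_partial (N : nat) (x : R) : R :=
  sum_f_R0 (fun n => Rabs (tanh_coef n) * x ^ n) N.

Lemma sum_conv_le (d : nat -> R) (N : nat) : (forall n, 0 <= d n) ->
  sum_f_R0 (fun n => sum_f_R0 (fun i => d i * d (n - i)%nat) n) N
  <= sum_f_R0 d N * sum_f_R0 d N.
Proof.
intros Hd; destruct N as [|N]; [simpl; lra|].
rewrite (cauchy_finite d d (S N)) by lia.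
rewrite <- Rplus_0_r at 1; apply Rplus_le_compat_l.
apply cond_pos_sum; intros k; apply cond_pos_sum; intros l; now apply Rmult_le_pos.
Qed.

Lemma is_derive_abs_partial (N : nat) (x : R) :
  is_derive (abs_partial (S N)) x
    (sum_f_R0 (fun n => INR (S n) * Rabs (tanh_coef (S n)) * x ^ n) N).
Proof.
induction N as [|N IH].
- unfold abs_partial; simpl; auto_derive; [exact I|simpl; ring].
- rewrite tech5.
  apply (is_derive_plus (abs_partial (S N))); [exact IH|].
  auto_derive; [exact I|].
  change (match N with 0%nat => 1 | S _ => INR N + 1 end) with (INR (S N)).
  rewrite (S_INR (S N)); simpl pow; ring.
Qed.

Lemma abs_partial_le_S (N : nat) (x : R) : 0 <= x -> abs_partial N x <= abs_partial (S N) x.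
Proof.
intros Hx; unfold abs_partial; simpl sum_f_R0.
assert (0 <= Rabs (tanh_coef (S N)) * x ^ S N); [|simpl in *; lra].
apply Rmult_le_pos; [apply Rabs_pos|now apply pow_le].
Qed.

Lemma abs_partial_nonneg (N : nat) (x : R) : 0 <= x -> 0 <= abs_partial N x.
Proof.
intros Hx; apply cond_pos_sum; intros n.
apply Rmult_le_pos; [apply Rabs_pos|now apply pow_le].
Qed.

Lemma abs_partial_deriv_le (N : nat) (x : R) : 0 <= x ->
  sum_f_R0 (fun n => INR (S n) * Rabs (tanh_coef (S n)) * x ^ n) N
  <= 1 + abs_partial (S N) x * abs_partial (S N) x.
Proof.
intros Hx; set (d := fun n => Rabs (tanh_coef n) * x ^ n).
assert (Hd : forall n, 0 <= d n).
{ intros n; apply Rmult_le_pos; [apply Rabs_pos|now apply pow_le]. }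
apply Rle_trans with (sum_f_R0 (fun n => unit_coef n
  + sum_f_R0 (fun i => d i * d (n - i)%nat) n) N).
- apply sum_Rle; intros n _.
  rewrite <- (Rabs_pos_eq (INR (S n))) by apply pos_INR.
  rewrite <- Rabs_mult, tanh_coef_rec.
  assert (Hu : Rabs (unit_coef n) * x ^ n = unit_coef n).
  { unfold unit_coef; destruct n; simpl; rewrite ?Rabs_R1, ?Rabs_R0; ring. }
  apply Rle_trans with ((Rabs (unit_coef n) + Rabs (PS_mult tanh_coef tanh_coef n)) * x ^ n).
  + apply Rmult_le_compat_r; [now apply pow_le|].
    eapply Rle_trans; [apply Rabs_triang|]; rewrite Rabs_Ropp; lra.
  + rewrite Rmult_plus_distr_r, Hu; apply Rplus_le_compat_l.
    eapply Rle_trans.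
    * apply Rmult_le_compat_r; [now apply pow_le|apply Rsum_abs].
    * rewrite Rmult_comm, scal_sum; right; apply sum_eq; intros i Hi.
      unfold d; rewrite Rabs_mult; replace n with (i + (n - i))%nat at 2 by lia.
      rewrite pow_add; ring.
- rewrite sum_plus; apply Rplus_le_compat.
  + right; destruct N as [|N]; [reflexivity|].
    rewrite decomp_sum by lia; rewrite (sum_eq _ (fun _ => 0)) by reflexivity.
    rewrite sum_cte; unfold unit_coef; simpl; ring.
  + eapply Rle_trans; [now apply sum_conv_le|].
    change (sum_f_R0 d N) with (abs_partial N x).
    apply Rmult_le_compat; try (now apply abs_partial_nonneg);
      now apply abs_partial_le_S.
Qed.

(** The partial sum [P] has [P' <= 1 + P^2] on the nonnegative axis, so
    [atan P(x) - x] decreases from 0. *)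
Lemma abs_partial_le_tan (N : nat) (x : R) : 0 <= x < PI / 2 -> abs_partial N x <= tan x.
Proof.
intros Hx; eapply Rle_trans; [apply abs_partial_le_S; lra|].
set (P := abs_partial (S N)).
set (dP := fun y => sum_f_R0 (fun n => INR (S n) * Rabs (tanh_coef (S n)) * y ^ n) N).
assert (Hg : forall y, is_derive (fun y => atan (P y) - y) y (dP y / (1 + (P y)²) - 1)).
{ intros y; apply (is_derive_minus (fun y => atan (P y)) (fun y => y));
    [|apply (is_derive_id (K := R_AbsRing))].
  apply (is_derive_comp atan P); [apply is_derive_atan|apply is_derive_abs_partial]. }
destruct (MVT_gen (fun y => atan (P y) - y) 0 x _ (fun y _ => Hg y)) as (c & Hc & Heq).
- intros y _; apply derivable_continuous_pt; eexists; apply is_derive_Reals, Hg.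
- rewrite Rmin_left, Rmax_right in Hc by lra.
  assert (HP0 : P 0 = 0).
  { unfold P, abs_partial; rewrite decomp_sum by lia; rewrite tanh_coef_0, Rabs_R0.
    rewrite (sum_eq _ (fun _ => 0)) by (intros; simpl; ring); rewrite sum_cte; ring. }
  cbv beta in Heq; rewrite HP0, atan_0 in Heq.
  assert (Hle : dP c / (1 + (P c)²) - 1 <= 0).
  { pose proof (Rle_0_sqr (P c)).
    assert (dP c <= 1 + (P c)²) by (apply abs_partial_deriv_le; lra).
    assert (dP c / (1 + (P c)²) <= 1); [|lra].
    apply Rle_div_l; lra. }
  assert (Hat : atan (P x) <= x) by nra.
  rewrite <- (tan_atan (P x)); pose proof (atan_bound (P x)).
  destruct Hat as [Hlt|Heq']; [left; apply tan_increasing; lra|right; now f_equal].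
Qed.

Lemma tanh_coef_abs_summable (x : R) : 0 <= x < PI / 2 ->
  ex_series (fun n => Rabs (tanh_coef n) * x ^ n).
Proof.
intros Hx; apply (ex_series_bounded _ (tan x)).
- intros n; apply Rmult_le_pos; [apply Rabs_pos|apply pow_le; lra].
- intros N; now apply abs_partial_le_tan.
Qed.

Lemma tanh_coef_radius_PI2 (x : R) : Rabs x < PI / 2 ->
  Rbar_lt (Rabs x) (CV_radius tanh_coef).
Proof.
apply lt_CV_radius_of_ball; intros z Hz; apply ex_pseries_R, ex_series_Rabs.
apply (ex_series_ext (fun n => Rabs (tanh_coef n) * Rabs z ^ n)).
- intros n; now rewrite Rabs_mult, RPow_abs.
- apply tanh_coef_abs_summable; split; [apply Rabs_pos|assumption].
Qed.

(** For [|x| < PI/2] the sum [S] of the series satisfies [S' = 1 - S^2], so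
    [S cosh - sinh] is a solution of the linear equation [y' = - S y] vanishing at 0. *)
Lemma tanh_pseries (x : R) : Rabs x < PI / 2 -> PSeries tanh_coef x = tanh x.
Proof.
intros Hx; pose proof (Rabs_pos x).
set (S := PSeries tanh_coef); set (J := PSeries (PS_Int tanh_coef)).
assert (HS : forall y, Rabs y < PI / 2 -> is_derive S y (1 - S y * S y)).
{ intros y Hy; assert (Hr := tanh_coef_radius_PI2 y Hy).
  replace (1 - S y * S y) with (PSeries (PS_derive tanh_coef) y);
    [now apply is_derive_PSeries|].
  rewrite (PSeries_ext _ (PS_minus unit_coef (PS_mult tanh_coef tanh_coef)))
    by (intros n; apply tanh_coef_rec).
  rewrite PSeries_minus; [|apply PSeries_unit_coef|now apply ex_pseries_mult].
  now rewrite (proj2 (PSeries_unit_coef y)), PSeries_mult. }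
assert (HJ : forall y, Rabs y < PI / 2 -> is_derive J y (S y)).
{ intros y Hy; assert (Hr := tanh_coef_radius_PI2 y Hy).
  replace (S y) with (PSeries (PS_derive (PS_Int tanh_coef)) y);
    [apply is_derive_PSeries; now rewrite CV_radius_Int|].
  apply PSeries_ext; intros n; unfold PS_derive, PS_Int; field; now apply not_0_INR. }
(* [J] is a primitive of [S], so that [exp J] is an integrating factor. *)
set (D := fun y => (S y * cosh y - sinh y) * exp (J y)).
assert (HD : forall y, Rabs y < PI / 2 -> is_derive D y 0).
{ intros y Hy; specialize (HS y Hy); specialize (HJ y Hy).
  unfold D, cosh, sinh; auto_derive.
  - repeat split; [now exists (1 - S y * S y)|now exists (S y)].
  - replace (Derive _ y) with (1 - S y * S y) by (symmetry; now apply is_derive_unique).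
    replace (Derive _ y) with (S y) by (symmetry; now apply is_derive_unique).
    field. }
assert (Heq : D x = D 0).
{ destruct (MVT_cor4 D (fun _ => 0) 0 (Rabs x)) with (b := x) as (c & Hc & _).
  - intros c Hc; rewrite Rminus_0_r in Hc; apply HD; lra.
  - rewrite Rminus_0_r; lra.
  - lra. }
unfold D in Heq.
assert (H0 : S 0 = 0) by (unfold S; rewrite PSeries_0; apply tanh_coef_0).
rewrite H0, sinh_0 in Heq.
assert (H1 : S x * cosh x - sinh x = 0).
{ apply (Rmult_eq_reg_r (exp (J x))); [|apply Rgt_not_eq, exp_pos].
  rewrite Heq; ring. }
unfold tanh; pose proof (cosh_pos x).
apply (Rmult_eq_reg_r (cosh x)); [field_simplify; lra|lra].
Qed.

(** * The expansion of calB *)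

Lemma sum_f_R0_pairs (g : nat -> R) (N : nat) :
  sum_f_R0 g (2 * N + 1) = sum_f_R0 (fun n => g (2 * n)%nat + g (2 * n + 1)%nat) N.
Proof.
induction N as [|N IH]; [reflexivity|].
replace (2 * S N + 1)%nat with (S (S (2 * N + 1))) by lia.
rewrite !tech5, IH; replace (2 * S N)%nat with (S (2 * N + 1)) by lia.
replace (S (2 * N + 1) + 1)%nat with (S (S (2 * N + 1))) by lia; ring.
Qed.

Lemma Series_odd_terms (d : nat -> R) :
  (forall i, d (2 * i)%nat = 0) -> ex_series d ->
  ex_series (fun i => d (2 * i + 1)%nat) /\ Series (fun i => d (2 * i + 1)%nat) = Series d.
Proof.
intros Hd Hex.
assert (H : is_series (fun i => d (2 * i + 1)%nat) (Series d)).
{ change (is_lim_seq (sum_n (fun i => d (2 * i + 1)%nat)) (Series d)).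
  apply (is_lim_seq_ext (fun N => sum_n d (2 * N + 1))).
  - intros N; rewrite !sum_n_Reals, sum_f_R0_pairs; apply sum_eq; intros i _.
    rewrite Hd; ring.
  - apply (is_lim_seq_subseq (sum_n d) _ (fun N => (2 * N + 1)%nat)).
    + apply eventually_subseq; intros n; lia.
    + exact (Series_correct d Hex). }
split; [now exists (Series d)|now apply is_series_unique].
Qed.

Lemma tanh_coef_odd_abs_summable (y : R) : 0 <= y < PI / 2 ->
  ex_series (fun i => Rabs (tanh_coef (2 * i + 1)) * y ^ (2 * i + 1)).
Proof.
intros Hy; apply (Series_odd_terms (fun n => Rabs (tanh_coef n) * y ^ n)).
- intros i; rewrite tanh_coef_even, Rabs_R0; ring.
- now apply tanh_coef_abs_summable.
Qed.

Lemma tanh_odd_series (y : R) : Rabs y < PI / 2 ->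
  ex_series (fun i => tanh_coef (2 * i + 1) * y ^ (2 * i + 1)) /\
  Series (fun i => tanh_coef (2 * i + 1) * y ^ (2 * i + 1)) = tanh y.
Proof.
intros Hy; rewrite <- tanh_pseries by assumption.
apply (Series_odd_terms (fun n => tanh_coef n * y ^ n)).
- intros i; rewrite tanh_coef_even; ring.
- now apply ex_pseries_R, CV_radius_inside, tanh_coef_radius_PI2.
Qed.

Lemma binomial_even_part (x h : R) (i : nat) :
  (x + h) ^ (2 * i + 1) - (x - h) ^ (2 * i + 1)
  = 2 * sum_f_R0 (fun n => Binomial.C (2 * i + 1) (2 * n) * x ^ (2 * n)
                           * h ^ (2 * i + 1 - 2 * n)) i.
Proof.
replace (x - h) with (x + - h) by ring.
rewrite !binomial, !sum_f_R0_pairs, <- minus_sum, scal_sum.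
apply sum_eq; intros n Hn.
replace (2 * i + 1 - (2 * n + 1))%nat with (2 * (i - n))%nat by lia.
replace (2 * i + 1 - 2 * n)%nat with (S (2 * (i - n))) by lia.
assert (Hev : (- h) ^ (2 * (i - n)) = h ^ (2 * (i - n))).
{ rewrite !pow_mult; f_equal; ring. }
rewrite Hev, <- !(tech_pow_Rmult _ (2 * (i - n))), Hev; ring.
Qed.

Lemma Series_finite_support (a : nat -> R) (N : nat) :
  (forall n, (N < n)%nat -> a n = 0) -> ex_series a /\ Series a = sum_f_R0 a N.
Proof.
intros Ha.
assert (H0 : forall k, a (S N + k)%nat = 0) by (intros k; apply Ha; lia).
assert (Hex : ex_series a).
{ apply (ex_series_incr_n a (S N)); apply (ex_series_bounded _ 0).
  - intros n; rewrite H0; lra.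
  - intros n; rewrite (sum_eq _ (fun _ => 0)) by (intros; apply H0).
    rewrite sum_cte; lra. }
split; [assumption|].
rewrite (Series_incr_n a (S N)) by (lia || assumption).
rewrite (Series_ext (fun k => a (S N + k)%nat) (fun k => 0 * a k))
  by (intros k; rewrite H0; ring).
rewrite Series_scal_l; simpl; ring.
Qed.

Lemma Series_drop_zeros (a : nat -> R) (n : nat) :
  (forall i, (i < n)%nat -> a i = 0) -> ex_series a ->
  Series a = Series (fun i => a (n + i)%nat).
Proof.
intros Ha Hex; destruct n as [|n]; [reflexivity|].
rewrite (Series_incr_n a (S n)) by (lia || assumption).
rewrite (sum_eq _ (fun _ => 0)) by (simpl; intros; apply Ha; lia).
rewrite sum_cte; ring.
Qed.

Lemma tanh_coef_odd (i : nat) :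
  tanh_coef (2 * i + 1)
  = 2 ^ (2 * S i) * (2 ^ (2 * S i) - 1) * bernoulli (2 * S i) / INR (fact (2 * S i)).
Proof.
change (tanh_coef (2 * i + 1))
  with (4 ^ S (2 * i + 1) * bern_egf (S (2 * i + 1)) - 2 ^ S (2 * i + 1) * bern_egf (S (2 * i + 1))
        + unit_coef (2 * i + 1)).
replace (unit_coef (2 * i + 1)) with 0
  by (unfold unit_coef; now replace (2 * i + 1 =? 0)%nat with false
        by (symmetry; apply Nat.eqb_neq; lia)).
replace (S (2 * i + 1)) with (2 * S i)%nat by lia; unfold bern_egf.
replace 4 with (2 * 2) by ring; rewrite Rpow_mult_distr; field; apply INR_fact_neq_0.
Qed.

(** The term of index [(i, n)] in the expansion of [calB kappa x] obtained from the
    Taylor series of [tanh] and the binomial theorem; column [n] carries [x^(2n)]. *)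
Definition bump_array (kappa x : R) (i n : nat) : R :=
  if (n <=? i)%nat then
    tanh_coef (2 * i + 1) / kappa ^ (2 * i + 1)
    * (Binomial.C (2 * i + 1) (2 * n) * x ^ (2 * n) * (1 / 2) ^ (2 * i + 1 - 2 * n))
  else 0.

Lemma bump_array_row (kappa x : R) (i : nat) : 0 < kappa -> 0 <= x ->
  ex_series (fun n => Rabs (bump_array kappa x i n)) /\
  Series (bump_array kappa x i)
  = / 2 * (tanh_coef (2 * i + 1) * ((x + 1 / 2) / kappa) ^ (2 * i + 1)
           - tanh_coef (2 * i + 1) * ((x - 1 / 2) / kappa) ^ (2 * i + 1)) /\
  Series (fun n => Rabs (bump_array kappa x i n))
  <= Rabs (tanh_coef (2 * i + 1)) * ((x + 1 / 2) / kappa) ^ (2 * i + 1).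
Proof.
intros Hk Hx.
assert (Hout : forall n, (i < n)%nat -> bump_array kappa x i n = 0).
{ intros n Hn; unfold bump_array.
  now replace (n <=? i)%nat with false by (symmetry; apply Nat.leb_gt; lia). }
assert (Hin : forall n, (n <= i)%nat -> bump_array kappa x i n =
  Binomial.C (2 * i + 1) (2 * n) * x ^ (2 * n) * (1 / 2) ^ (2 * i + 1 - 2 * n)
  * (tanh_coef (2 * i + 1) / kappa ^ (2 * i + 1))).
{ intros n Hn; unfold bump_array.
  replace (n <=? i)%nat with true by (symmetry; apply Nat.leb_le; lia); ring. }
assert (Hkp : 0 < kappa ^ (2 * i + 1)) by now apply pow_lt.
assert (Hdiv : forall u, (u / kappa) ^ (2 * i + 1) = u ^ (2 * i + 1) / kappa ^ (2 * i + 1)).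
{ intros u; unfold Rdiv; now rewrite Rpow_mult_distr, pow_inv. }
pose proof (binomial_even_part x (1 / 2) i) as Hbin.
destruct (Series_finite_support (bump_array kappa x i) i Hout) as [_ H1].
destruct (Series_finite_support (fun n => Rabs (bump_array kappa x i n)) i) as [H2 H3].
{ intros n Hn; rewrite Hout, Rabs_R0; trivial. }
split; [assumption|split].
- rewrite H1, (sum_eq _ _ _ Hin), <- scal_sum.
  rewrite !Hdiv.
  replace (sum_f_R0 _ i) with (((x + 1 / 2) ^ (2 * i + 1) - (x - 1 / 2) ^ (2 * i + 1)) / 2)
    by (rewrite Hbin; field).
  field; lra.
- rewrite H3, (sum_eq _ (fun n => Binomial.C (2 * i + 1) (2 * n) * x ^ (2 * n)
    * (1 / 2) ^ (2 * i + 1 - 2 * n) * (Rabs (tanh_coef (2 * i + 1)) / kappa ^ (2 * i + 1)))).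
  + rewrite <- scal_sum.
    replace (sum_f_R0 _ i) with (((x + 1 / 2) ^ (2 * i + 1) - (x - 1 / 2) ^ (2 * i + 1)) / 2)
      by (rewrite Hbin; field).
    rewrite Hdiv.
    assert (Hm : - (x - 1 / 2) ^ (2 * i + 1) <= (x + 1 / 2) ^ (2 * i + 1)).
    { apply Rle_trans with (Rabs (x - 1 / 2) ^ (2 * i + 1)).
      - rewrite RPow_abs, <- Rabs_Ropp; apply Rle_abs.
      - apply pow_incr; split; [apply Rabs_pos|apply Rabs_le; lra]. }
    assert (Ht : 0 <= Rabs (tanh_coef (2 * i + 1)) / kappa ^ (2 * i + 1)).
    { apply Rmult_le_pos; [apply Rabs_pos|now apply Rlt_le, Rinv_0_lt_compat]. }
    replace (Rabs (tanh_coef (2 * i + 1)) * ((x + 1 / 2) ^ (2 * i + 1) / kappa ^ (2 * i + 1)))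
      with ((x + 1 / 2) ^ (2 * i + 1) * (Rabs (tanh_coef (2 * i + 1)) / kappa ^ (2 * i + 1)))
      by (field; lra).
    rewrite (Rmult_comm (_ / kappa ^ _)); apply Rmult_le_compat_r; [assumption|lra].
  + intros n Hn; rewrite (Hin n Hn), Rabs_mult; f_equal.
    * apply Rabs_pos_eq; apply Rmult_le_pos; [|apply pow_le; lra].
      apply Rmult_le_pos; [apply binomial_coef_nonneg|now apply pow_le].
    * unfold Rdiv; rewrite Rabs_mult; f_equal.
      now apply Rabs_pos_eq, Rlt_le, Rinv_0_lt_compat.
Qed.

Lemma bump_array_shift (kappa x : R) (n i : nat) : 0 < kappa ->
  let j := (n + 1 + i)%nat in
  bump_array kappa x (n + i) n
  = x ^ (2 * n) * (2 ^ (2 * n) * (2 ^ (2 * j) - 1) * bernoulli (2 * j)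
    / (INR j * INR (fact (2 * j - 2 * n - 1)) * INR (fact (2 * n)) * kappa ^ (2 * j - 1))).
Proof.
intros Hk j; unfold bump_array.
replace (n <=? n + i)%nat with true by (symmetry; apply Nat.leb_le; lia).
replace (2 * j - 1)%nat with (2 * (n + i) + 1)%nat by (unfold j; lia).
replace (2 * j - 2 * n - 1)%nat with (2 * i + 1)%nat by (unfold j; lia).
replace (2 * (n + i) + 1 - 2 * n)%nat with (2 * i + 1)%nat by lia.
replace (tanh_coef (2 * (n + i) + 1))
  with (2 ^ (2 * j) * (2 ^ (2 * j) - 1) * bernoulli (2 * j) / INR (fact (2 * j))).
2: { rewrite tanh_coef_odd; replace (S (n + i)) with j by (unfold j; lia); reflexivity. }
unfold Binomial.C.
replace (2 * (n + i) + 1 - 2 * n)%nat with (2 * i + 1)%nat by lia.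
assert (Hf : INR (fact (2 * j)) = 2 * INR j * INR (fact (2 * (n + i) + 1))).
{ replace (2 * j)%nat with (S (2 * (n + i) + 1)) by (unfold j; lia).
  rewrite fact_simpl, mult_INR; f_equal.
  replace (S (2 * (n + i) + 1)) with (2 * j)%nat by (unfold j; lia).
  rewrite mult_INR; reflexivity. }
rewrite Hf.
assert (H2 : 2 ^ (2 * j) = 2 * 2 ^ (2 * n) * 2 ^ (2 * i + 1)).
{ replace (2 * j)%nat with (S (2 * n + (2 * i + 1))) by (unfold j; lia).
  rewrite <- tech_pow_Rmult, pow_add; ring. }
assert (Hh : (1 / 2) ^ (2 * i + 1) = / 2 ^ (2 * i + 1)).
{ rewrite <- pow_inv; f_equal; field. }
rewrite Hh; rewrite H2 at 1.
assert (HJ : INR j <> 0) by (apply not_0_INR; unfold j; lia).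
assert (Hp : 2 ^ (2 * i + 1) <> 0) by (apply pow_nonzero; lra).
assert (Hkp : kappa ^ (2 * (n + i) + 1) <> 0) by (apply pow_nonzero; lra).
field; repeat split; try assumption; apply INR_fact_neq_0.
Qed.

Lemma sinh_pos (x : R) : 0 < x -> 0 < sinh x.
Proof.
intros Hx; unfold sinh; assert (exp (- x) < exp x) by (apply exp_increasing; lra); lra.
Qed.

Lemma tanh_pos (x : R) : 0 < x -> 0 < tanh x.
Proof. intros Hx; apply Rdiv_lt_0_compat; [now apply sinh_pos|apply cosh_pos]. Qed.

Lemma calB_0 (kappa : R) : 0 < kappa -> calB kappa 0 = tanh (1 / (2 * kappa)).
Proof.
intros Hk; unfold calB; set (u := 1 / (2 * kappa)).
replace ((0 + 1 / 2) / kappa) with u by (unfold u; field; lra).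
replace ((0 - 1 / 2) / kappa) with (- u) by (unfold u; field; lra).
assert (tanh (- u) = - tanh u); [|lra].
unfold tanh, sinh, cosh; rewrite Ropp_involutive.
pose proof (exp_pos u); pose proof (exp_pos (- u)); field; lra.
Qed.

Lemma kappa_pos (kappa : R) : 3 / PI < kappa -> 0 < kappa.
Proof.
intros Hk; apply Rlt_trans with (3 / PI); [|assumption].
apply Rdiv_lt_0_compat; [lra|apply PI_RGT_0].
Qed.

(** Rows of the array sum to half the difference of the Taylor terms of [tanh] at
    [(x + 1/2)/kappa] and [(x - 1/2)/kappa], columns to [acoef kappa n * x^(2n)] up to
    the factor [calB kappa 0].  The rearrangement is
    absolutely convergent as soon as [(x + 1/2)/kappa < PI/2], which on the whole
    interval [0, 1] is the condition [3/PI < kappa]. *)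
Lemma acoef_expansion (kappa x : R) : 3 / PI < kappa -> 0 <= x <= 1 ->
  ex_series (fun n => Rabs (acoef kappa n * x ^ (2 * n))) /\
  Series (fun n => acoef kappa n * x ^ (2 * n)) = calB kappa x / calB kappa 0.
Proof.
intros Hk Hx; pose proof PI_RGT_0 as HPI.
pose proof (kappa_pos kappa Hk) as Hk0.
assert (Hlim : 3 / 2 / kappa < PI / 2).
{ apply (Rmult_lt_compat_r PI) in Hk; [|assumption].
  replace (3 / PI * PI) with 3 in Hk by (field; lra).
  apply Rlt_div_l; lra. }
assert (Hinv : 0 < / kappa) by now apply Rinv_0_lt_compat.
assert (Hp : 0 <= (x + 1 / 2) / kappa < PI / 2).
{ split; [apply Rmult_le_pos; lra|].
  apply Rle_lt_trans with (3 / 2 / kappa); [apply Rmult_le_compat_r; lra|assumption]. }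
assert (Hm : Rabs ((x - 1 / 2) / kappa) < PI / 2).
{ apply Rle_lt_trans with ((x + 1 / 2) / kappa); [|apply Hp].
  unfold Rdiv at 1; rewrite Rabs_mult, (Rabs_pos_eq (/ kappa)) by lra.
  apply Rmult_le_compat_r; [lra|apply Rabs_le; lra]. }
set (T := tanh (1 / (2 * kappa))).
assert (HT : 0 < T).
{ apply tanh_pos, Rdiv_lt_0_compat; lra. }
pose proof (fun i => bump_array_row kappa x i Hk0 (proj1 Hx)) as Hrow.
destruct (fubini (bump_array kappa x)) as (Hc1 & Hc2 & Heq).
{ intros i; apply Hrow. }
{ apply (ex_series_le (V := R_CompleteNormedModule) _
    (fun i => Rabs (tanh_coef (2 * i + 1)) * ((x + 1 / 2) / kappa) ^ (2 * i + 1))).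
  - intros i; change (Rabs (Series (fun n => Rabs (bump_array kappa x i n)))
      <= Rabs (tanh_coef (2 * i + 1)) * ((x + 1 / 2) / kappa) ^ (2 * i + 1)).
    rewrite Rabs_pos_eq; [apply Hrow|].
    apply Series_nonneg; [intros; apply Rabs_pos|apply Hrow].
  - now apply tanh_coef_odd_abs_summable. }
assert (Hcol : forall n, Series (fun i => bump_array kappa x i n)
  = T * (acoef kappa n * x ^ (2 * n))).
{ intros n; rewrite (Series_drop_zeros _ n).
  - rewrite (Series_ext _ _ (fun i => bump_array_shift kappa x n i Hk0)), Series_scal_l.
    unfold acoef; fold T; cbv zeta; field; lra.
  - intros i Hi; unfold bump_array.
    now replace (n <=? i)%nat with false by (symmetry; apply Nat.leb_gt; lia).
  - apply ex_series_Rabs, Hc1. }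
split.
- apply (ex_series_ext (fun n => / T * Rabs (Series (fun i => bump_array kappa x i n)))).
  + intros n; rewrite Hcol, Rabs_mult, (Rabs_pos_eq T) by lra.
    now rewrite <- Rmult_assoc, Rinv_l, Rmult_1_l by lra.
  + apply (ex_series_scal_l (V := R_NormedModule)).
    apply ex_series_abs_le with (fun n => Series (fun i => Rabs (bump_array kappa x i n)));
      [|assumption].
    intros n; apply (Series_Rabs (fun i => bump_array kappa x i n)), Hc1.
- rewrite calB_0 by assumption; fold T; apply (Rmult_eq_reg_l T); [|lra].
  replace (T * (calB kappa x / T)) with (calB kappa x) by (field; lra).
  rewrite <- Series_scal_l, <- (Series_ext _ _ Hcol), Heq.
  rewrite (Series_ext _ _ (fun i => proj1 (proj2 (Hrow i)))), Series_scal_l.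
  destruct (tanh_odd_series ((x + 1 / 2) / kappa)) as [H1 H2];
    [rewrite Rabs_pos_eq; apply Hp|].
  destruct (tanh_odd_series ((x - 1 / 2) / kappa)) as [H3 H4]; [assumption|].
  rewrite Series_minus, H2, H4 by assumption; unfold calB; field.
Qed.

Lemma acoef_abs_summable (kappa : R) : 3 / PI < kappa ->
  ex_series (fun n => Rabs (acoef kappa n)).
Proof.
intros Hk; destruct (acoef_expansion kappa 1 Hk) as [H _]; [lra|].
eapply ex_series_ext; [|exact H]; intros n; simpl; now rewrite pow1, Rmult_1_r.
Qed.

Lemma acoef_pseries (kappa x : R) : 3 / PI < kappa -> 0 <= x <= 1 ->
  PSeries (acoef kappa) (x ^ 2) = calB kappa x / calB kappa 0.
Proof.
intros Hk Hx; rewrite <- (proj2 (acoef_expansion kappa x Hk Hx)).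
apply Series_ext; intros n; now rewrite pow_mult.
Qed.

(** * The reciprocal series *)

Lemma tanh_minus (a b : R) : tanh a - tanh b = sinh (a - b) / (cosh a * cosh b).
Proof.
pose proof (cosh_pos a); pose proof (cosh_pos b).
replace (sinh (a - b)) with (sinh a * cosh b - cosh a * sinh b); [unfold tanh; field; lra|].
unfold sinh, cosh, Rminus; rewrite !Ropp_plus_distr, Ropp_involutive, !exp_plus; field.
Qed.

(** Up to a constant factor [1 / calB] is a shifted hyperbolic cosine, so the reciprocal series is entire even
    though the expansion of [calB] has a finite radius of convergence. *)
Lemma calB_closed_form (kappa x : R) : kappa <> 0 ->
  calB kappa x = sinh (1 / kappa) / (cosh (2 * x / kappa) + cosh (1 / kappa)).
Proof.
intros Hk; unfold calB; rewrite tanh_minus.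
replace ((x + 1 / 2) / kappa - (x - 1 / 2) / kappa) with (1 / kappa) by (field; assumption).
set (u := (x + 1 / 2) / kappa); set (v := (x - 1 / 2) / kappa).
replace (2 * x / kappa) with (u + v) by (unfold u, v; field; assumption).
assert (H : cosh (u + v) + cosh (1 / kappa) = 2 * (cosh u * cosh v)).
{ replace (1 / kappa) with (u - v) by (unfold u, v; field; assumption).
  unfold cosh, Rminus; rewrite !Ropp_plus_distr, Ropp_involutive, !exp_plus; field. }
rewrite H; pose proof (cosh_pos u); pose proof (cosh_pos v); field; lra.
Qed.

Lemma exp_coef_even_pseries (y : R) :
  ex_pseries (fun n => exp_coef (2 * n)) (y ^ 2) /\
  PSeries (fun n => exp_coef (2 * n)) (y ^ 2) = cosh y.
Proof.
assert (Hsub : forall j, (forall n, n <= j n)%nat ->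
  ex_pseries (fun n => exp_coef (j n)) (y ^ 2)).
{ intros j Hj; apply ex_pseries_R.
  apply (ex_series_le (V := R_CompleteNormedModule) _ (fun n => exp_coef n * (y ^ 2) ^ n)).
  - intros n; change (Rabs (exp_coef (j n) * (y ^ 2) ^ n) <= exp_coef n * (y ^ 2) ^ n).
    assert (Hy : 0 <= (y ^ 2) ^ n) by (apply pow_le, pow2_ge_0).
    rewrite Rabs_mult, (Rabs_pos_eq ((y ^ 2) ^ n)) by assumption.
    apply Rmult_le_compat_r; [assumption|]; unfold exp_coef.
    rewrite Rabs_pos_eq by apply Rlt_le, Rinv_0_lt_compat, INR_fact_lt_0.
    apply Rinv_le_contravar; [apply INR_fact_lt_0|apply le_INR, fact_le, Hj].
  - apply ex_pseries_R; eexists; apply is_exp_Reals. }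
assert (He : ex_pseries (fun n => exp_coef (2 * n)) (y ^ 2))
  by (apply (Hsub (fun n => (2 * n)%nat)); intros; lia).
assert (Ho : ex_pseries (fun n => exp_coef (2 * n + 1)) (y ^ 2))
  by (apply (Hsub (fun n => (2 * n + 1)%nat)); intros; lia).
split; [assumption|].
assert (Hy : (- y) ^ 2 = y ^ 2) by ring.
unfold cosh; rewrite !exp_Reals; change (fun n => / INR (fact n)) with exp_coef.
rewrite (PSeries_odd_even exp_coef y) by assumption.
rewrite (PSeries_odd_even exp_coef (- y)) by (rewrite Hy; assumption).
rewrite Hy; field.
Qed.

(** The Taylor coefficients, in [x^2], of [calB kappa 0 / calB kappa x]. *)
Definition bcoef (kappa : R) : nat -> R :=
  PS_scal (/ (1 + cosh (1 / kappa)))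
    (PS_plus (fun n => ((2 / kappa) ^ 2) ^ n * exp_coef (2 * n))
             (PS_scal (cosh (1 / kappa)) unit_coef)).

Lemma bcoef_pseries (kappa x : R) : 0 < kappa ->
  ex_pseries (bcoef kappa) (x ^ 2) /\
  PSeries (bcoef kappa) (x ^ 2) = calB kappa 0 / calB kappa x.
Proof.
intros Hk.
destruct (exp_coef_even_pseries (2 / kappa * x)) as [H1 H2].
rewrite Rpow_mult_distr in H1, H2.
rewrite <- PSeries_dilate in H2.
assert (Hex1 : ex_pseries (fun n => ((2 / kappa) ^ 2) ^ n * exp_coef (2 * n)) (x ^ 2)).
{ apply ex_pseries_R; apply ex_pseries_R in H1.
  eapply ex_series_ext; [|exact H1]; intros n.
  change (exp_coef (2 * n) * ((2 / kappa) ^ 2 * x ^ 2) ^ n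
    = ((2 / kappa) ^ 2) ^ n * exp_coef (2 * n) * (x ^ 2) ^ n).
  rewrite Rpow_mult_distr; ring. }
destruct (PSeries_unit_coef (x ^ 2)) as [Hu1 Hu2].
assert (Hex2 : ex_pseries (PS_scal (cosh (1 / kappa)) unit_coef) (x ^ 2))
  by (apply ex_pseries_scal; [apply Rmult_comm|assumption]).
split.
- apply ex_pseries_scal; [apply Rmult_comm|].
  now apply (ex_pseries_plus (V := R_NormedModule)).
- unfold bcoef; rewrite PSeries_scal, PSeries_plus, PSeries_scal, Hu2, H2 by assumption.
  rewrite !calB_closed_form by lra.
  replace (2 * 0 / kappa) with 0 by (field; lra); rewrite cosh_0.
  replace (2 / kappa * x) with (2 * x / kappa) by (field; lra).
  assert (0 < sinh (1 / kappa)) by (apply sinh_pos, Rdiv_lt_0_compat; lra).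
  pose proof (cosh_pos (1 / kappa)); pose proof (cosh_pos (2 * x / kappa)).
  field; repeat split; lra.
Qed.

Lemma bcoef_nonneg (kappa : R) (n : nat) : 0 <= bcoef kappa n.
Proof.
pose proof (cosh_pos (1 / kappa)).
change (0 <= / (1 + cosh (1 / kappa)) * (((2 / kappa) ^ 2) ^ n * exp_coef (2 * n)
  + cosh (1 / kappa) * unit_coef n)).
apply Rmult_le_pos; [apply Rlt_le, Rinv_0_lt_compat; lra|].
apply Rplus_le_le_0_compat; apply Rmult_le_pos.
- apply pow_le, pow2_ge_0.
- apply Rlt_le, Rinv_0_lt_compat, INR_fact_lt_0.
- lra.
- unfold unit_coef; destruct (Nat.eqb n 0); lra.
Qed.

Lemma bcoef_abs_summable (kappa : R) : 0 < kappa ->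
  ex_series (fun n => Rabs (bcoef kappa n)).
Proof.
intros Hk; destruct (bcoef_pseries kappa 1 Hk) as [H _]; apply ex_pseries_R in H.
eapply ex_series_ext; [|exact H]; intros n.
rewrite !pow1, Rmult_1_r; symmetry; apply Rabs_pos_eq, bcoef_nonneg.
Qed.

(** One-sided uniqueness: continuity at 0 kills the constant coefficient, and dividing
    by the variable shifts the others down. *)
Lemma pseries_zero_right (r : R) : 0 < r -> forall (n : nat) (c : nat -> R),
  (forall z, Rabs z < r -> Rbar_lt (Rabs z) (CV_radius c)) ->
  (forall z, 0 < z < r -> PSeries c z = 0) -> c n = 0.
Proof.
intros Hr.
assert (H0 : forall c : nat -> R,
  (forall z, Rabs z < r -> Rbar_lt (Rabs z) (CV_radius c)) ->
  (forall z, 0 < z < r -> PSeries c z = 0) -> c 0%nat = 0).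
{ intros c Hrad Hz.
  destruct (Req_dec (c 0%nat) 0) as [|Hc]; [assumption|exfalso].
  assert (Hcont : continuity_pt (PSeries c) 0)
    by (apply PSeries_continuity, Hrad; rewrite Rabs_R0; assumption).
  destruct (Hcont (Rabs (c 0%nat))) as (d & Hd & Hlt); [now apply Rabs_pos_lt|].
  set (z := Rmin d r / 2).
  assert (Hzb : 0 < z < d /\ z < r).
  { pose proof (Rmin_l d r); pose proof (Rmin_r d r).
    assert (0 < Rmin d r) by now apply Rmin_pos.
    unfold z; lra. }
  specialize (Hlt z); rewrite (Hz z), PSeries_0 in Hlt by lra.
  change (D_x no_cond 0 z /\ Rabs (z - 0) < d -> Rabs (0 - c 0%nat) < Rabs (c 0%nat)) in Hlt.
  rewrite (Rminus_0_l (c 0%nat)), Rabs_Ropp in Hlt.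
  assert (Rabs (c 0%nat) < Rabs (c 0%nat)); [|lra].
  apply Hlt; split; [split; [exact I|lra]|].
  rewrite Rminus_0_r, Rabs_pos_eq; lra. }
induction n as [|n IH]; intros c Hrad Hz; [now apply H0|].
apply (IH (PS_decr_1 c)).
- intros z Hzr; rewrite CV_radius_decr_1; now apply Hrad.
- intros z Hzr; apply (Rmult_eq_reg_l z); [|lra].
  pose proof (PSeries_decr_1 c z) as Hd; rewrite (H0 c Hrad Hz), Hz in Hd by assumption.
  rewrite Rmult_0_r, Hd, Rplus_0_l; [reflexivity|].
  apply CV_radius_inside, Hrad; rewrite Rabs_pos_eq; lra.
Qed.

Lemma radius_of_abs_summable (a : nat -> R) (z : R) :
  ex_series (fun n => Rabs (a n)) -> Rabs z < 1 -> Rbar_lt (Rabs z) (CV_radius a).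
Proof.
intros Ha; apply lt_CV_radius_of_ball; clear z; intros z Hz.
apply ex_pseries_R, ex_series_Rabs.
apply (ex_series_ext (fun n => Rabs (a n * Rabs z ^ n))).
- intros n; now rewrite !Rabs_mult, <- !RPow_abs, Rabs_Rabsolu.
- apply ex_series_abs_pseries; [assumption|pose proof (Rabs_pos z); lra].
Qed.

Lemma calB_pos (kappa x : R) : 0 < kappa -> 0 < calB kappa x.
Proof.
intros Hk; rewrite calB_closed_form by lra.
pose proof (cosh_pos (2 * x / kappa)); pose proof (cosh_pos (1 / kappa)).
apply Rdiv_lt_0_compat; [apply sinh_pos, Rdiv_lt_0_compat; lra|lra].
Qed.

Lemma acoef_0 (kappa : R) : 3 / PI < kappa -> acoef kappa 0 = 1.
Proof.
intros Hk; rewrite <- PSeries_0.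
replace 0 with (0 ^ 2) by ring; rewrite acoef_pseries by lra.
pose proof (calB_pos kappa 0 (kappa_pos kappa Hk)); field; lra.
Qed.

Lemma bcoef_conv (kappa : R) (k : nat) : 3 / PI < kappa ->
  PS_mult (bcoef kappa) (acoef kappa) k = unit_coef k.
Proof.
intros Hk; pose proof (kappa_pos kappa Hk) as Hk0.
pose proof (acoef_abs_summable kappa Hk) as Ha.
pose proof (bcoef_abs_summable kappa Hk0) as Hb.
apply Rminus_diag_uniq.
assert (Hex : forall z, Rabs z < 1 -> ex_pseries (PS_mult (bcoef kappa) (acoef kappa)) z).
{ intros z Hz; apply ex_pseries_mult; now apply radius_of_abs_summable. }
apply (pseries_zero_right 1 Rlt_0_1 k
  (PS_minus (PS_mult (bcoef kappa) (acoef kappa)) unit_coef)).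
- intros z; apply lt_CV_radius_of_ball; clear z; intros z Hz.
  apply (ex_pseries_minus (PS_mult (bcoef kappa) (acoef kappa)) unit_coef);
    [now apply Hex|apply PSeries_unit_coef].
- intros z Hz; assert (Hz1 : Rabs z < 1) by (rewrite Rabs_pos_eq; lra).
  destruct (PSeries_unit_coef z) as [Hu1 Hu2].
  rewrite PSeries_minus, Hu2, PSeries_mult; try assumption;
    try (now apply radius_of_abs_summable); [|now apply Hex].
  rewrite <- (sqrt_sqrt z) by lra.
  replace (sqrt z * sqrt z) with (sqrt z ^ 2) by ring.
  assert (Hs : 0 <= sqrt z <= 1).
  { split; [apply sqrt_pos|rewrite <- sqrt_1; apply sqrt_le_1; lra]. }
  rewrite (proj2 (bcoef_pseries kappa (sqrt z) Hk0)), acoef_pseries by assumption.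
  pose proof (calB_pos kappa 0 Hk0); pose proof (calB_pos kappa (sqrt z) Hk0).
  field; lra.
Qed.

(** In the [k]-th equation the unknown [b k] has coefficient [a 0], so the equations
    can be solved one after the other. *)
Lemma conv_inverse_unique (a b b' : nat -> R) : a 0%nat <> 0 ->
  (forall k, PS_mult b a k = PS_mult b' a k) -> forall k, b k = b' k.
Proof.
intros Ha H k; induction k as [k IH] using (well_founded_induction lt_wf).
specialize (H k); unfold PS_mult in H; destruct k as [|k].
- simpl in H; now apply (Rmult_eq_reg_r (a 0%nat)).
- rewrite !tech5, Nat.sub_diag in H.
  rewrite (sum_eq _ (fun i => b' i * a (S k - i)%nat)) in H
    by (intros i Hi; rewrite IH by lia; reflexivity).
  apply (Rmult_eq_reg_r (a 0%nat)); [lra|assumption].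
Qed.

(** * Complex series in coordinates and the inversion formula *)

Lemma sum_n_C (u : nat -> C) (n : nat) :
  sum_n u n = (sum_f_R0 (fun k => Re (u k)) n, sum_f_R0 (fun k => Im (u k)) n).
Proof.
induction n as [|n IH]; [rewrite sum_O; apply surjective_pairing|].
rewrite sum_Sn, IH; reflexivity.
Qed.

Lemma ex_series_C (u : nat -> C) :
  ex_series (fun n => Re (u n)) -> ex_series (fun n => Im (u n)) -> ex_series u.
Proof.
intros [p Hp] [q Hq]; exists (p, q); intros P [e HP].
assert (H1 := Hp _ (locally_ball p e)); assert (H2 := Hq _ (locally_ball q e)).
destruct H1 as [N1 H1]; destruct H2 as [N2 H2]; exists (Nat.max N1 N2); intros n Hn.
apply HP; rewrite sum_n_C, <- !sum_n_Reals; split; [apply H1|apply H2]; lia.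
Qed.

Lemma RtoC_mult_pair (r : R) (z : C) : (RtoC r * z)%C = (r * Re z, r * Im z).
Proof. destruct z; unfold Cmult, RtoC, Re, Im; simpl; f_equal; ring. Qed.

Lemma inv_Rcpow (y : R) (s : C) (r : R) : 0 < y ->
  (RtoC r / Rcpow y s)%C = (r * osc (Im s) 1 0 (Re s) y, r * osc (Im s) 0 (-1) (Re s) y).
Proof.
intros Hy; destruct s as [sigma t].
unfold Rcpow, Cexp, osc, Cdiv, Cinv, Cmult, RtoC, Re, Im; simpl fst; simpl snd.
replace (sigma * ln y - t * 0) with (sigma * ln y) by ring.
replace (sigma * 0 + t * ln y) with (t * ln y) by ring.
replace (- sigma * ln y) with (- (sigma * ln y)) by ring; rewrite exp_Ropp.
set (E := exp (sigma * ln y)); assert (HE : 0 < E) by apply exp_pos.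
set (c := cos (t * ln y)); set (d := sin (t * ln y)).
assert (H : E * c * (E * c * 1) + E * d * (E * d * 1) = E ^ 2).
{ pose proof (sin2_cos2 (t * ln y)) as H; unfold Rsqr in H; fold c d in H.
  replace (E * c * (E * c * 1) + E * d * (E * d * 1)) with (E ^ 2 * (d * d + c * c)) by ring.
  rewrite H; ring. }
rewrite H; f_equal; field; lra.
Qed.

(** [n ^ -s] in coordinates, twisted by a real weight: the complex Euler-transformed
    series is a pair of real ones. *)
Lemma CSeries_eulerT (s : C) (w : nat -> R) :
  CSeries (fun k => (RtoC (1 / 2 ^ (k + 1)) *
    sum_n (fun m => RtoC (Binomial.C k m) * (RtoC ((-1) ^ m) / Rcpow (INR (m + 1)) s)
                    * RtoC (w m)) k)%C)
  = (Series (eulerT (fun m => osc (Im s) 1 0 (Re s) (INR m + 1) * w m)),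
     Series (eulerT (fun m => osc (Im s) 0 (-1) (Re s) (INR m + 1) * w m))).
Proof.
assert (H : forall m k, (RtoC (Binomial.C k m) * (RtoC ((-1) ^ m) / Rcpow (INR (m + 1)) s)
    * RtoC (w m))%C
  = (Binomial.C k m * ((-1) ^ m * (osc (Im s) 1 0 (Re s) (INR m + 1) * w m)),
     Binomial.C k m * ((-1) ^ m * (osc (Im s) 0 (-1) (Re s) (INR m + 1) * w m)))).
{ intros m k; rewrite inv_Rcpow by (apply lt_0_INR; lia).
  rewrite plus_INR; change (INR 1) with 1.
  unfold Cmult, RtoC; simpl; f_equal; ring. }
assert (HE : forall k, (RtoC (1 / 2 ^ (k + 1)) *
    sum_n (fun m => RtoC (Binomial.C k m) * (RtoC ((-1) ^ m) / Rcpow (INR (m + 1)) s)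
                    * RtoC (w m)) k)%C
  = (eulerT (fun m => osc (Im s) 1 0 (Re s) (INR m + 1) * w m) k,
     eulerT (fun m => osc (Im s) 0 (-1) (Re s) (INR m + 1) * w m) k)).
{ intros k; rewrite (sum_n_ext _ _ k (fun m => H m k)), sum_n_C, RtoC_mult_pair.
  reflexivity. }
unfold CSeries; f_equal; apply Series_ext; intros k; now rewrite HE.
Qed.

Lemma eta_pair (s : C) :
  eta s = (Series (eulerT (fun m => osc (Im s) 1 0 (Re s) (INR m + 1))),
           Series (eulerT (fun m => osc (Im s) 0 (-1) (Re s) (INR m + 1)))).
Proof.
transitivity (CSeries (fun k => (RtoC (1 / 2 ^ (k + 1)) *
    sum_n (fun m => RtoC (Binomial.C k m) * (RtoC ((-1) ^ m) / Rcpow (INR (m + 1)) s)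
                    * RtoC 1) k)%C)).
- assert (H : forall k, sum_n (fun m => RtoC (Binomial.C k m)
      * (RtoC ((-1) ^ m) / Rcpow (INR (m + 1)) s) * RtoC 1)%C k
    = sum_n (fun m => RtoC (Binomial.C k m)
      * (RtoC ((-1) ^ m) / Rcpow (INR (m + 1)) s))%C k).
  { intros k; apply sum_n_ext; intros m; apply Cmult_1_r. }
  unfold eta, CSeries; f_equal; apply Series_ext; intros k; now rewrite H.
- rewrite (CSeries_eulerT s (fun _ => 1)); f_equal; apply Series_ext; intros k;
    apply eulerT_ext; intros m; apply Rmult_1_r.
Qed.

Definition shift_base (nu : R) (m : nat) : R := exp (- (2 * nu) * ln (INR m + 1)).

Lemma shift_base_bounds (nu : R) (m : nat) : 0 < nu -> 0 <= shift_base nu m <= 1.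
Proof.
intros Hnu; split; [apply Rlt_le, exp_pos|]; unfold shift_base.
assert (Hln : 0 <= ln (INR m + 1)).
{ rewrite <- ln_1; apply ln_le; pose proof (pos_INR m); lra. }
assert (H : - (2 * nu) * ln (INR m + 1) <= 0) by nra.
apply Rle_trans with (exp 0); [|rewrite exp_0; lra].
destruct H as [H| ->]; [left; now apply exp_increasing|lra].
Qed.

Lemma osc_shift (nu A B : R) (s : C) (n m : nat) :
  osc (Im (s + RtoC (2 * nu * INR n))%C) A B (Re (s + RtoC (2 * nu * INR n))%C) (INR m + 1)
  = osc (Im s) A B (Re s) (INR m + 1) * shift_base nu m ^ n.
Proof.
unfold shift_base; rewrite osc_mult_exp; destruct s as [sigma t].
unfold Cplus, RtoC, Re, Im; simpl; now rewrite Rplus_0_r.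
Qed.

Lemma weight_shift_base (kappa nu : R) (m : nat) : 3 / PI < kappa -> 0 < nu ->
  let x := 1 / Rpower (INR (m + 1)) nu in
  PSeries (acoef kappa) (shift_base nu m) = calB kappa x / calB kappa 0 /\
  PSeries (bcoef kappa) (shift_base nu m) = calB kappa 0 / calB kappa x.
Proof.
intros Hk Hnu x.
assert (Hx : x = exp (- nu * ln (INR m + 1))).
{ unfold x, Rpower; rewrite plus_INR; change (INR 1) with 1.
  unfold Rdiv; rewrite Rmult_1_l, <- exp_Ropp; f_equal; ring. }
assert (Hz : shift_base nu m = x ^ 2).
{ rewrite Hx, exp_pow_INR; unfold shift_base; f_equal; simpl; ring. }
assert (Hx1 : 0 <= x <= 1).
{ split; [rewrite Hx; apply Rlt_le, exp_pos|].
  pose proof (shift_base_bounds nu m Hnu) as [_ H]; rewrite Hz in H.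
  destruct (Rle_lt_dec x 1); [assumption|nra]. }
rewrite Hz; split; [now apply acoef_pseries|].
now apply bcoef_pseries, kappa_pos.
Qed.

Lemma eta_kn_pair (kappa nu : R) (s : C) : 3 / PI < kappa -> 0 < nu ->
  eta_kn kappa nu s
  = (Series (eulerT (fun m => osc (Im s) 1 0 (Re s) (INR m + 1)
                              * PSeries (acoef kappa) (shift_base nu m))),
     Series (eulerT (fun m => osc (Im s) 0 (-1) (Re s) (INR m + 1)
                              * PSeries (acoef kappa) (shift_base nu m)))).
Proof.
intros Hk Hnu; unfold eta_kn.
rewrite (CSeries_eulerT s (fun m => calB kappa (1 / Rpower (INR (m + 1)) nu) / calB kappa 0)).
f_equal; apply Series_ext; intros k; apply eulerT_ext; intros m;
  now rewrite (proj1 (weight_shift_base kappa nu m Hk Hnu)).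
Qed.

(** Both expansions of the theorem are instances: [f], [g] are the coordinates of
    [(m+1)^-s] with [c] the [a_n], then the same coordinates twisted by the values of
    [sum_n a_n z^n] with [c] the [b_n]. *)
Lemma CSeries_superposition (c : nat -> R) (F G : C) (f g z : nat -> R) (u : nat -> C) :
  (forall m, 0 <= z m <= 1) -> ex_series (fun n => Rabs (c n)) -> c 0%nat = 1 ->
  tame f z -> tame g z ->
  (forall n, u n = Cmult (RtoC (c (n + 1)%nat))
     (Series (eulerT (fun m => f m * z m ^ (n + 1))),
      Series (eulerT (fun m => g m * z m ^ (n + 1))))) ->
  F = (Series (eulerT f), Series (eulerT g)) ->
  G = (Series (eulerT (fun m => f m * PSeries c (z m))),
       Series (eulerT (fun m => g m * PSeries c (z m)))) ->
  ex_series u /\ G = (F + CSeries u)%C.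
Proof.
intros Hz Hc Hc0 Hf Hg Hu -> ->.
destruct (superposition_tail f z c Hz Hc Hc0 Hf) as [Ef ->].
destruct (superposition_tail g z c Hz Hc Hc0 Hg) as [Eg ->].
assert (HRe : forall n, c (n + 1)%nat * Series (eulerT (fun m => f m * z m ^ (n + 1)))
  = Re (u n)) by (intros n; rewrite Hu, RtoC_mult_pair; reflexivity).
assert (HIm : forall n, c (n + 1)%nat * Series (eulerT (fun m => g m * z m ^ (n + 1)))
  = Im (u n)) by (intros n; rewrite Hu, RtoC_mult_pair; reflexivity).
split.
- apply ex_series_C; [now apply (ex_series_ext _ _ HRe)|now apply (ex_series_ext _ _ HIm)].
- unfold CSeries; now rewrite <- (Series_ext _ _ HRe), <- (Series_ext _ _ HIm).
Qed.

Theorem theorem3p2 :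
  forall kappa nu : R, 3 / PI < kappa -> 0 < nu ->
  (forall s : C,
     let u := fun n : nat =>
       (RtoC (acoef kappa (n + 1)) * eta (s + RtoC (2 * nu * INR (n + 1))))%C in
     ex_series u /\ eta_kn kappa nu s = (eta s + CSeries u)%C) /\
  (forall b : nat -> R,
     (forall k : nat,
        sum_n (fun n => b n * acoef kappa (k - n)) k = if Nat.eqb k 0 then 1 else 0) ->
     forall s : C,
       let v := fun n : nat =>
         (RtoC (b (n + 1)%nat)
          * eta_kn kappa nu (s + RtoC (2 * nu * INR (n + 1))))%C in
       ex_series v /\ eta s = (eta_kn kappa nu s + CSeries v)%C).
Proof.
intros kappa nu Hk Hnu; pose proof (kappa_pos kappa Hk) as Hk0.
assert (Hz := fun m => shift_base_bounds nu m Hnu).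
assert (Ha := acoef_abs_summable kappa Hk).
assert (Htame : forall s A B,
  tame (fun m => osc (Im s) A B (Re s) (INR m + 1)) (shift_base nu))
  by (intros; apply tame_osc; lra).
split.
- intros s u.
  apply (CSeries_superposition (acoef kappa) _ _
    (fun m => osc (Im s) 1 0 (Re s) (INR m + 1))
    (fun m => osc (Im s) 0 (-1) (Re s) (INR m + 1)) (shift_base nu));
    try assumption; try apply Htame.
  + now apply acoef_0.
  + intros n; unfold u; rewrite eta_pair; do 2 f_equal; apply Series_ext; intros k;
      apply eulerT_ext; intros m; apply osc_shift.
  + apply eta_pair.
  + now apply (eta_kn_pair kappa nu s).
- intros b Hb s v.
  assert (Hbb : forall k, b k = bcoef kappa k).
  { apply (conv_inverse_unique (acoef kappa)); [rewrite acoef_0 by assumption; lra|].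
    intros k; rewrite bcoef_conv by assumption.
    unfold PS_mult; rewrite <- sum_n_Reals; apply Hb. }
  set (w := fun m => PSeries (acoef kappa) (shift_base nu m)).
  assert (Hw : forall A B, tame (fun m => osc (Im s) A B (Re s) (INR m + 1) * w m)
    (shift_base nu)) by (intros; now apply tame_superposition).
  assert (Hcancel : forall m, w m * PSeries (bcoef kappa) (shift_base nu m) = 1).
  { intros m; destruct (weight_shift_base kappa nu m Hk Hnu) as [H1 H2].
    unfold w; rewrite H1, H2.
    pose proof (calB_pos kappa 0 Hk0).
    pose proof (calB_pos kappa (1 / Rpower (INR (m + 1)) nu) Hk0); field; lra. }
  apply (CSeries_superposition (bcoef kappa) _ _
    (fun m => osc (Im s) 1 0 (Re s) (INR m + 1) * w m)
    (fun m => osc (Im s) 0 (-1) (Re s) (INR m + 1) * w m) (shift_base nu));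
    try assumption; try apply Hw.
  + now apply bcoef_abs_summable.
  + rewrite <- Hbb; specialize (Hb 0%nat); rewrite sum_O in Hb; simpl in Hb.
    now rewrite acoef_0, Rmult_1_r in Hb by assumption.
  + intros n; unfold v; rewrite eta_kn_pair, Hbb by assumption.
    do 2 f_equal; apply Series_ext; intros k; apply eulerT_ext; intros m;
      rewrite osc_shift; fold (w m); ring.
  + now apply (eta_kn_pair kappa nu s).
  + rewrite eta_pair; f_equal; apply Series_ext; intros k; apply eulerT_ext; intros m;
      rewrite Rmult_assoc, Hcancel; ring.
Qed.
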